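(* Let $\mathbb K$ be a field of characteristic $0$, $x\in\mathbb K$, and let $D$ be a dissection diagram of degree $n\ge1$. Then $$L(D)=\sum_{i=1}^{n}\sum_{t=0}^{f_D(i)}x^{k_{\{a_i\}}(\Phi_{i,t}(D))}\,\Phi_{i,t}(D)+\sum_{\tau=0}^{f_D(0)}\left[\Phi^0_{0,\tau}(D)+\Phi^1_{0,\tau}(D)\right],$$ where $a_i=\{i,i+1\}$. In other words, $$L(D)=\sum_{i=1}^{n}\sum_{t=0}^{l(i)-1}\Phi_{i,t}(D)+x\sum_{i=1}^{n}\sum_{t=l(i)}^{f_D(i)}\Phi_{i,t}(D)+\sum_{\tau=0}^{f_D(0)}\left[\Phi^0_{0,\tau}(D)+\Phi^1_{0,\tau}(D)\right],$$ where for each $i\in\{1,\dots,n\}$, $l(i)$ is the unique integer in $\{1,\dots,f_D(i)\}$ such that the chord $a^i_{D,l(i)}$ of $D$ is the one labelled $i$.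
   Context: Dissection diagrams. For $n\ge 0$ let $\Pi_n$ be the regular $(n+1)$-gon with vertices $0,1,\dots,n$ numbered clockwise; vertex $0$ is the root. For $0\le i\le n$, side $i$ goes from vertex $i$ to vertex $i+1$ (with $n+1$ read as $0$). A chord $\{u,v\}$ is a segment joining two distinct vertices (adjacent vertices are allowed; such a chord is distinct from the side). A dissection diagram of degree $n$ is a set of $n$ pairwise non-crossing chords (they may share endpoints) of $\Pi_n$ forming an acyclic graph, hence a spanning tree on $\{0,\dots,n\}$. All chords are oriented towards the root; the chord labelled $i$ ($1\le i\le n$) is the unique chord going out of vertex $i$. $\mathrm{Ch}(D)$ is the set of chords of $D$. The diagram of degree $0$ is identified with $1$; $a$ denotes the diagram of degree $1$. Coproduct. $\mathcal H_D$ is the commutative polynomial algebra on dissection diagrams of positive degree, with $\Delta(D)=\sum_{C\subset \mathrm{Ch}(D)}x^{k_C(D)}q_C(D)\otimes r_C(D)$ (with $x^0=1$). Here the $p=|C|$ chords of $C$ cut the polygon into $p+1$ faces; for a face $\alpha$ let $S_C(\alpha)$ be the (nonempty) set of sides of the polygon bordering $\alpha$. $q_C(D)$ is obtained by contracting every chord of $C$ to a point: each face $\alpha$ becomes a polygon with set of sides $S_C(\alpha)$, rooted at the starting vertex of its side of minimal label, carrying the chords of $D$ not in $C$ that lie in $\alpha$; this is a dissection diagram, and $q_C(D)$ is the product of these over all faces. $r_C(D)$ is the dissection diagram of degree $p$ obtained by keeping the chords of $C$ and contracting all sides which are not the minimal side of their face, the root being the image of $0$. $k_C(D)$ is the number of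 chords of $C$ whose orientation in $D$ is opposite to their orientation (towards the root) in $r_C(D)$. The map $L$. For a dissection diagram $D$ of degree $n\ge 1$, $L(D)=D\circ a=\sum_G c(D,a;G)\,G$, sum over dissection diagrams $G$, where $c(D,a;G)$ is the coefficient of $D\otimes a$ in $\Delta(G)$. Chords at a vertex. The fertility $f_D(i)$ is the number of chords of $D$ having $i$ as an endpoint. These chords are listed as $a^i_{D,1},\dots,a^i_{D,f_D(i)}$ in the order in which their other endpoints are met in the sequence $i-1,i-2,\dots,0,n,n-1,\dots,i+1$ (for $i=0$: $n,n-1,\dots,1$). Insertion of a chord. Let $D$ have degree $n\ge1$. - For $1\le i\le n$, $0\le t\le f_D(i)$, $\Phi_{i,t}(D)$ is the dissection diagram of degree $n+1$ whose chords are $\{i,i+1\}$ and the images of the chords of $D$ under: an endpoint $u<i$ stays $u$; an endpoint $u>i$ becomes $u+1$; the endpoint $i$ of a chord stays $i$ if the chord is one of $a^i_{D,1},\dots,a^i_{D,t}$ and becomes $i+1$ otherwise. - For $0\le\tau\le f_D(0)$, $\Phi^0_{0,\tau}(D)$ is the dissection diagram of degree $n+1$ whose chords are $\{0,n+1\}$ and the images of the chords of $D$ under: nonzero endpoints are unchanged; the endpoint $0$ becomes $n+1$ for the chords $a^0_{D,1},\dots,a^0_{D,\tau}$ and stays $0$ otherwise. - For $0\le\tau\le f_D(0)$, $\Phi^1_{0,\tau}(D)$ is the dissection diagram of degree $n+1$ whose chords are $\{0,1\}$ and the images of the chords of $D$ under: an endpoint $v\ge1$ becomes $v+1$; the endpoint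 $0$ stays $0$ for the chords $a^0_{D,1},\dots,a^0_{D,\tau}$ and becomes $1$ otherwise. *)

(* Defs.v *)
From HB Require Import structures.
From mathcomp Require Import classical_sets fsbigop.
From mathcomp Require Import all_boot all_order all_algebra.
From mathcomp.multinomials Require Import monalg.

Set Implicit Arguments.
Unset Strict Implicit.
Unset Printing Implicit Defensive.

Import GRing.Theory.
Local Open Scope ring_scope.

(* 'I_n.+1 indexes both the vertices and the sides of the (n+1)-gon: side i   *)
(* starts at vertex i. A chord is the two-element set of its endpoints.       *)
Notation chords n := {set {set 'I_n.+1}}.

Section Diagrams.
Variable n : nat.
Implicit Types (E C : chords n) (c d : {set 'I_n.+1}) (u v s i : 'I_n.+1).

Definition crossing c d : bool :=
  [exists u, exists u', exists v, exists v',
    [&& c == [set u; v], d == [set u'; v'],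
        (u < u')%N, (u' < v)%N & (v < v')%N]].

Definition adjacent E u v : bool := (u != v) && ([set u; v] \in E).

(* A simple cycle has at most n+1 vertices, which makes the quantification    *)
(* over its length finite; ucycles of size at most 2 are degenerate.          *)
Definition acyclic E : bool :=
  [forall m : 'I_n.+2, forall p : m.-tuple 'I_n.+1,
    (cycle (adjacent E) p && uniq p) ==> (size p < 3)%N].

Definition is_diagram E : bool :=
  [&& #|E| == n,
      [forall c in E, #|c| == 2%N],
      [forall c in E, forall d in E, ~~ crossing c d]
    & acyclic E].

(* The chord c of E goes out of u when oriented towards the root: its other   *)
(* endpoint is the one from which the root is reached without using c.        *)
Definition goes_out E c u : bool :=
  (c \in E) &&
  [exists v, (c == [set u; v]) && connect (adjacent (E :\ c)) v ord0].

(* Side s lies on the arc of the polygon between the endpoints of c that      *)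
(* avoids side n. For a vertex s that is not an endpoint of c, this also      *)
(* says that s is strictly on the corresponding side of c.                    *)
Definition under c s : bool :=
  [exists u in c, exists v in c, (u <= s < v)%N].

(* Two sides border the same face iff no chord of C separates them.           *)
Definition same_face C s s' : bool :=
  [forall c in C, under c s == under c s'].

(* A face is represented by its set of sides. *)
Definition faces C : {set {set 'I_n.+1}} :=
  equivalence_partition (same_face C) [set: 'I_n.+1].

(* No endpoint of d is separated from the sides of F by a chord of C.         *)
Definition lies_in C (F : {set 'I_n.+1}) d : bool :=
  [forall c in C, forall s in F, forall u in d,
    (u \notin c) ==> (under c u == under c s)].

(* Image of the vertex u in the polygon whose sides are those in S, rooted at *)
(* the starting vertex of the least side in S, everything else having been    *)
(* contracted: u becomes the starting vertex of the first side in S met from  *)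
(* u on, cyclically.                                                          *)
Definition contract (S : {set 'I_n.+1}) u : 'I_(#|S|.-1).+1 :=
  inord (#|[set s in S | (s < u)%N]| %% #|S|).

Definition q_face E C (F : {set 'I_n.+1}) : chords #|F|.-1 :=
  [set contract F @: d | d : {set 'I_n.+1} in E :\: C & lies_in C F d].

Definition min_sides C : {set 'I_n.+1} :=
  [set s | [forall s', same_face C s s' ==> (s <= s')%N]].

Definition r_part C : chords #|min_sides C|.-1 :=
  [set contract (min_sides C) @: c | c : {set 'I_n.+1} in C].

End Diagrams.

Definition k_part n (E C : chords n) : nat :=
  #|[set c in C | [exists u, exists v,
      [&& c == [set u; v], goes_out E c u &
          goes_out (r_part C) (contract (min_sides C) @: c)
                   (contract (min_sides C) v)]]]|.

Section ChordsAtAVertex.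
Variable n : nat.
Implicit Types (E : chords n) (i : 'I_n.+1).

Definition fertility E i : nat := #|[set c in E | i \in c]|.

(* i-1, i-2, ..., 0, n, n-1, ..., i+1 *)
Definition turn i : seq 'I_n.+1 :=
  rev (take i (enum 'I_n.+1)) ++ rev (drop i.+1 (enum 'I_n.+1)).

(* The chord a^i_{E,t} is nth set0 (fan E i) t.-1, for t from 1 on.           *)
Definition fan E i : seq {set 'I_n.+1} :=
  [seq c <- [seq [set i; v] | v <- turn i] | c \in E].

Definition insert_chord (e : {set 'I_n.+2})
    (mv : {set 'I_n.+1} -> 'I_n.+1 -> nat) E : chords n.+1 :=
  e |: [set [set inord (mv c u) | u in c] | c : {set 'I_n.+1} in E].

Definition side_chord i : {set 'I_n.+2} := [set inord i; inord i.+1].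

Definition Phi i (t : nat) E : chords n.+1 :=
  insert_chord (side_chord i)
    (fun c u => if (u < i)%N then u : nat
                else if (i < u)%N then u.+1
                else if c \in take t (fan E i) then i : nat else i.+1) E.

Definition Phi0 (t : nat) E : chords n.+1 :=
  insert_chord [set ord0; ord_max]
    (fun c u => if u != ord0 then u : nat
                else if c \in take t (fan E ord0) then n.+1 else 0%N) E.

Definition Phi1 (t : nat) E : chords n.+1 :=
  insert_chord [set ord0; inord 1]
    (fun c u => if u != ord0 then u.+1
                else if c \in take t (fan E ord0) then 0%N else 1%N) E.

End ChordsAtAVertex.

Record diagram (n : nat) := Diagram {
  chords_of :> chords n;
  diagramP : is_diagram chords_of
}.
HB.instance Definition _ n := [isSub for @chords_of n].
HB.instance Definition _ n := [Finite of diagram n by <:].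

Definition any_diagram := {n : nat & diagram n}.
HB.instance Definition _ := Choice.on any_diagram.
Definition mk_any n (D : diagram n) : any_diagram := existT _ n D.

Definition generator := {D : any_diagram | (0 < tag D)%N}.
HB.instance Definition _ := Choice.on generator.

Notation monomial := {cmonom generator}.

(* The diagram of degree 0 is identified with 1.                              *)
Definition monD (D : any_diagram) : monomial :=
  if insub D is Some g then ucm g else mone.

(* The default value is a totality device: every chord set to which this      *)
(* function is applied in what follows is a dissection diagram.               *)
Definition mon n (E : chords n) : monomial :=
  if insub E is Some D then monD (mk_any D) else mone.

Definition a_chords : chords 1 := [set [set ord0; ord_max]].

Definition q_part n (E C : chords n) : monomial :=
  \big[mmul/mone]_(F in faces C) mon (q_face E C F).

Notation HD K := {malg K[monomial]}.

(* HD (x) HD, through its basis of pairs of monomials. *)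
Notation HD2 K := {malg K[(monomial * monomial)%type]}.

Section Hopf.
Variable K : fieldType.

Definition Delta (x : K) n (G : diagram n) : HD2 K :=
  \sum_(C : chords n | C \subset chords_of G)
    << x ^+ k_part G C *g (q_part G C, mon (r_part C)) >>.

Definition coef (x : K) n (D : diagram n) m (G : diagram m) : K :=
  mcoeff (mon D, mon a_chords) (Delta x G).

Definition diag n (E : chords n) : HD K := << mon E >>.

(* Sum over the infinite set of all dissection diagrams, of any degree, of a  *)
(* family with finite support.                                                *)
Definition L (x : K) n (D : diagram n) : HD K :=
  \sum_(G \in (@classical_sets.setT any_diagram))
     coef x D (tagged G) *: diag (tagged G).

End Hopf.

(* Main.v *)
Require Import Defs.
From mathcomp Require Import all_boot all_order all_algebra.
From mathcomp.multinomials Require Import monalg.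
From mathcomp Require Import zify.
From mathcomp Require fsbigop.
Import GRing.Theory.
Local Open Scope ring_scope.

Set Implicit Arguments.
Unset Strict Implicit.
Unset Printing Implicit Defensive.

(** The coefficient of G in L(D) counts, with weights, the sets C of chords of G
    whose quotient has degree one and whose complementary part is D.

    Two distinct chords separate three sides of the polygon from one another
    ([two_faces]), so C consists of a single chord c. Both faces of c then carry
    dissection diagrams ([q_face_diagrams]): contraction keeps connectedness, and
    since G has only as many chords as a tree needs, no chord is wasted in either
    face. Their product is the generator D only if one of the two diagrams has
    degree zero, that is, if c cuts off a single side, and then D is obtained from
    G by contracting c ([q_part_generator], [q_part_edge]). So G has degree n+1
    and c is one of the n+2 chords parallel to a side j of its polygon:
    {j, j+1} for j <= n, and {n+1, 0} for j = n+1.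

    It remains to find, for each j, the trees G containing this chord whose
    contraction is D ([contraction_fibre]). Such a G is D with one vertex i split
    into two consecutive copies joined by the new chord, each chord of D at i
    being attached to one of the copies. Splitting keeps connectedness and the
    number of chords, hence trees; and there is no crossing exactly if the chords
    attached to the first copy come before the others in the fan at i
    ([expand_noncrossing], [contraction_expand]). So the first t chords of the fan
    go to the first copy, for one t from 0 to the fertility of i. The side j = i
    with 1 <= i <= n gives the diagrams Phi, the side 0 gives Phi1, and the side
    n+1 gives Phi0.

    The weight is x to the power 1 or 0. In the quotient, the new chord goes out
    of its smaller endpoint unless this is the root ([k_part1]). In G it goes out
    of the second copy exactly if the first copy keeps the chord of D that leads
    from i to the root ([goes_out_expand]), that is, if l(i) <= t; this is the
    second form of the formula. *)

(** * Spanning trees *)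

Section Trees.
Variable n : nat.
Implicit Types (E : chords n) (e : {set 'I_n.+1}) (u v x y : 'I_n.+1).

Definition connected E : Prop := forall u v, connect (adjacent E) u v.

Definition pairs E : bool := [forall c in E, #|c| == 2%N].

(** Acyclicity in the form used throughout: no chord is redundant for
    connectedness. It agrees with the absence of simple cycles by [acyclicP]. *)
Definition forest E : Prop :=
  forall u v, u != v -> [set u; v] \in E ->
    ~~ connect (adjacent (E :\ [set u; v])) u v.

Lemma adjacent_sym E : symmetric (adjacent E).
Proof. by move=> u v; rewrite /adjacent eq_sym setUC. Qed.

Lemma connect_adjC E : connect_sym (adjacent E).
Proof. exact: sym_connect_sym (@adjacent_sym E). Qed.

Lemma set2_eqP u v x y :
  [set u; v] = [set x; y] -> (u = x /\ v = y) \/ (u = y /\ v = x).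
Proof.
move=> eq2; have := set21 u v; have := set22 u v; rewrite !eq2 !inE.
have := set21 x y; have := set22 x y; rewrite -!eq2 !inE.
by do 4![case/orP=> /eqP ?]; subst; auto.
Qed.

Lemma set2_inj u : injective (fun v => [set u; v]).
Proof. by move=> v w /set2_eqP[[_]|[-> ->]]. Qed.

Lemma pairsP E :
  reflect (forall c, c \in E -> exists u v, u != v /\ c = [set u; v]) (pairs E).
Proof.
apply: (iffP forall_inP) => E2 c cE.
  by have /cards2P[u [v [uv ->]]] := E2 c cE; exists u, v.
by have [u [v [uv ->]]] := E2 c cE; rewrite cards2 uv.
Qed.

Lemma connect_adjW E E' u v :
  E \subset E' -> connect (adjacent E) u v -> connect (adjacent E') u v.
Proof.
move=> sE; apply: connect_sub => x y /andP[xy xyE].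
by apply: connect1; rewrite /adjacent xy (subsetP sE).
Qed.

Lemma forestW E E' : E \subset E' -> forest E' -> forest E.
Proof.
move=> sE fE' u v uv uvE; apply: contra (fE' u v uv (subsetP sE _ uvE)).
by apply: connect_adjW; apply: setSD.
Qed.

Lemma connect_add E x y : x != y ->
  connect (adjacent ([set x; y] |: E)) x y.
Proof. by move=> xy; apply: connect1; rewrite /adjacent xy setU11. Qed.

(** A canonical-representative map of the connected components is updated by a
    new edge: if the edge joins two components, one representative disappears,
    so their number drops by at most one, and by exactly one in a forest. *)
Lemma component_map E : pairs E -> exists f : 'I_n.+1 -> 'I_n.+1,
  [/\ forall u v, (f u == f v) = connect (adjacent E) u v,
      (n < #|codom f| + #|E|)%N
    & forest E -> (#|codom f| + #|E| = n.+1)%N].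
Proof.
have [k leEk] := ubnP #|E|; elim: k E leEk => // k IHk E leEk pE.
have [-> | [e eE]] := set_0Vmem E.
  exists id; rewrite cards0 addn0 card_codom // card_ord; split=> // u v.
  apply/eqP/idP=> [-> // | /connectP[[|w p] //= /andP[/andP[_]]]].
  by rewrite inE.
have [x [y [xy e_xy]]] := pairsP _ pE e eE.
have cE : #|E| = (#|E :\ e|).+1 by rewrite (cardsD1 e E) eE.
have [||f [fP f_ge f_eq]] := IHk (E :\ e).
- by rewrite -cE.
- by apply/pairsP => c /setD1P[_]; exact: (pairsP _ pE).
have EE : E = [set x; y] |: (E :\ e) by rewrite -e_xy setD1K.
pose g u := if f u == f x then f y else f u.
have gP u v : (g u == g v) = connect (adjacent E) u v.
  apply/idP/idP.
    have cxy : connect (adjacent E) x y by rewrite EE; apply: connect_add.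
    have fE a b : f a = f b -> connect (adjacent E) a b.
      by move=> fab; apply: connect_adjW (subD1set E e) _; rewrite -fP fab.
    rewrite /g; have [ux|ux] := eqVneq (f u) (f x);
      have [vx|vx] := eqVneq (f v) (f x) => /eqP.
    - by move=> _; apply: fE; rewrite ux vx.
    - by move=> yv; exact: connect_trans (fE _ _ ux) (connect_trans cxy (fE _ _ yv)).
    - move=> uy; apply: connect_trans (fE _ _ uy) _.
      by rewrite connect_adjC; apply: connect_trans (fE _ _ vx) cxy.
    - exact: fE.
  case/connectP=> p; elim: p u => [|w p IHp] u /= => [_ -> // | /andP[uw pw] lv].
  apply: eq_trans (IHp _ pw lv); congr (_ == _).
  case/andP: uw => uw; rewrite {1}EE in_setU1 => /orP[/eqP/set2_eqP | uwE].
    by case=> [[-> ->]|[-> ->]]; rewrite /g eqxx; case: eqP.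
  have /eqP fuw : f u == f w by rewrite fP connect1 // /adjacent uw.
  by rewrite /g fuw.
exists g; split=> //.
  have sub : codom f \subset f x |: [set z in codom g].
    apply/subsetP=> z /codomP[u ->]; rewrite !inE.
    have [-> // | ux] := eqVneq (f u) (f x).
    by apply/codomP; exists u; rewrite /g (negPf ux).
  apply: leq_trans f_ge _; rewrite cE addnS -addSn leq_add2r.
  apply: leq_trans (subset_leq_card sub) _; rewrite cardsU1 cardsE.
  by case: (_ \notin _); [exact: leqnn | exact: leqnSn].
move=> fE; have nxy : f x != f y by rewrite fP e_xy; apply: fE; rewrite // -e_xy.
have := f_eq (forestW (subD1set E e) fE).
suff -> : #|codom f| = (#|codom g|).+1 by rewrite cE addnS.
have -> : #|codom f| = #|f x |: [set z in codom g]|.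
  apply: eq_card => z; rewrite !inE; apply/codomP/orP=> [[u ->]|].
    have [ux | ux] := eqVneq (f u) (f x); first by left.
    by right; apply/codomP; exists u; rewrite /g (negPf ux).
  case=> [/eqP-> | /codomP[u ->]]; first by exists x.
  by rewrite /g; case: ifP => _; [exists y | exists u].
rewrite cardsU1 cardsE inE; case: codomP => [[u]|] //.
rewrite /g; case: eqP => [_ /eqP | // ]; first by rewrite (negPf nxy).
by move=> + eq; rewrite -eq.
Qed.

Lemma adjacent_pairs E : adjacent [set c in E | #|c| == 2%N] =2 adjacent E.
Proof.
move=> u v; rewrite /adjacent inE cards2.
by case: eqVneq => //= _; rewrite andbT.
Qed.

Lemma connected_card E : connected E ->
  (n <= #|[set c in E | #|c| == 2%N]|)%N.
Proof.
set E2 := finset _ => cE.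
have pE2 : pairs E2 by apply/forall_inP => c; rewrite inE => /andP[].
have [f [fP f_ge _]] := component_map pE2.
suff : (#|codom f| <= 1)%N by lia.
rewrite -(cards1 (f ord0)); apply/subset_leq_card/subsetP=> z /codomP[u ->].
by rewrite inE fP (eq_connect (@adjacent_pairs E)).
Qed.

Lemma forest_connected E : pairs E -> forest E -> #|E| = n -> connected E.
Proof.
move=> pE fE cE u v; have [f [fP _ f_eq]] := component_map pE.
have /cards1P[z fz] : #|[set z in codom f]| == 1%N.
  by rewrite cardsE; have := f_eq fE; rewrite cE => /(@addIn n _ 1%N) ->.
have fz1 w : f w = z by apply/set1P; rewrite -fz inE codom_f.
by rewrite -fP !fz1.
Qed.

Lemma connected_forest E : connected E -> (#|E| <= n)%N -> forest E.
Proof.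
move=> cE leE u v uv uvE; apply/negP=> cuv.
suff /connected_card cE' : connected (E :\ [set u; v]).
  move: leE; rewrite (cardsD1 [set u; v] E) uvE leqNgt ltnS.
  rewrite (leq_trans cE') //; apply/subset_leq_card/subsetP=> c.
  by rewrite inE => /andP[].
move=> a b; have := cE a b; apply: connect_sub => x y /andP[xy xyE].
have [/set2_eqP[[-> ->]|[-> ->]] // | ne] := eqVneq [set x; y] [set u; v].
  by rewrite connect_adjC.
by apply: connect1; rewrite /adjacent xy in_setD1 ne.
Qed.

Lemma path_avoid E v u p : v \notin u :: p -> forall w,
  path (adjacent E) u p -> path (adjacent (E :\ [set w; v])) u p.
Proof.
elim: p u => //= x p IHp u; rewrite inE negb_or => /andP[vu vxp] w.
case/andP=> /andP[ux uxE] px; rewrite IHp // andbT /adjacent ux !inE uxE andbT.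
apply/eqP=> /set2_eqP[[_ xv]|[uv _]].
  by rewrite xv mem_head in vxp.
by rewrite uv eqxx in vu.
Qed.

Lemma acyclicP E : reflect (forest E) (acyclic E).
Proof.
apply: (iffP idP) => [acE u v uv uvE | fE].
  apply/negP=> /connectP[p0 path_p0 lv].
  case/shortenP: path_p0 lv => p pp up _ lv.
  have sz : (size (u :: p) < n.+2)%N.
    by rewrite -(card_uniqP up) ltnS (leq_trans (max_card _)) // card_ord.
  have := forallP (forallP acE (Ordinal sz)) (in_tuple (u :: p)).
  rewrite up andbT /= rcons_path -lv.
  have sub x y : adjacent (E :\ [set u; v]) x y -> adjacent E x y.
    by case/andP=> xy /setD1P[_ xyE]; rewrite /adjacent xy.
  rewrite (sub_path sub pp) /adjacent eq_sym uv setUC uvE /= !ltnS.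
  case: p pp lv {up sz} => [_ /= vu|w [|//]]; first by rewrite vu eqxx in uv.
  by rewrite /= andbT => /andP[_ /setD1P[ne _]] vw; rewrite vw eqxx in ne.
apply/forallP=> m; apply/forallP=> p; apply/implyP=> /andP[].
case: {p}(tval p) => [|u [|v [|w q]]] //= /andP[uv /andP[vw pw]] uq.
have [uvn uvE] := andP uv; have [vwn vwE] := andP vw.
have /negP[] := fE u v uvn uvE.
have nvq : v \notin w :: rcons q u.
  move: uq; rewrite /= !inE mem_rcons !inE !negb_or; case/and3P.
  by case/and3P=> vu _ _ /andP[-> ->]; rewrite eq_sym vu.
rewrite connect_adjC; apply/connectP; exists (w :: rcons q u) => /=; last first.
  by rewrite last_rcons.
rewrite (path_avoid nvq) // andbT /adjacent vwn in_setD1 vwE andbT.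
apply/eqP=> /set2_eqP[[vu _] | [_ wu]].
  by rewrite vu eqxx in uvn.
by move: uq; rewrite wu /= !inE eqxx orbT.
Qed.

Definition noncrossing E : bool :=
  [forall c in E, forall d in E, ~~ crossing c d].

Lemma noncrossingP E : reflect (forall u v u' v', [set u; v] \in E ->
   [set u'; v'] \in E -> ~~ ((u < u')%N && (u' < v)%N && (v < v')%N)) (noncrossing E).
Proof.
apply: (iffP idP) => [nE u v u' v' uvE uvE' | nE].
  apply: contra (forall_inP (forall_inP nE _ uvE) _ uvE') => /andP[/andP[l1 l2] l3].
  apply/existsP; exists u; apply/existsP; exists u'.
  apply/existsP; exists v; apply/existsP; exists v'.
  by rewrite !eqxx l1 l2 l3.
apply/forall_inP=> c cE; apply/forall_inP=> d dE; apply/negP.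
case/existsP=> u /existsP[u' /existsP[v /existsP[v']]].
case/and5P=> /eqP cuv /eqP duv l1 l2 l3.
by have := nE u v u' v'; rewrite -cuv -duv cE dE l1 l2 l3 => /(_ isT isT).
Qed.

Lemma is_diagramP E : reflect [/\ #|E| = n, pairs E, noncrossing E & forest E]
  (is_diagram E).
Proof.
by apply: (iffP and4P) => -[/eqP? ? ? /acyclicP?]; split=> //; apply/eqP.
Qed.

Lemma diagram_connected E : is_diagram E -> connected E.
Proof. by case/is_diagramP=> cE pE _ fE; apply: forest_connected. Qed.

(** The counting criterion behind every construction below: a connected graph
    needs n edges with two distinct endpoints, so if it has at most n elements
    then none is wasted, and it is a tree. *)
Lemma connected_diagram E :
  connected E -> (#|E| <= n)%N -> noncrossing E -> is_diagram E.
Proof.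
move=> cE leE nE; have := connected_card cE => ge2.
have sub : [set c in E | #|c| == 2%N] \subset E.
  by apply/subsetP=> c; rewrite inE => /andP[].
have /eqP E2 : [set c in E | #|c| == 2%N] == E.
  by rewrite eqEcard sub (leq_trans leE).
apply/is_diagramP; split=> //; last exact: connected_forest.
  by apply/eqP; rewrite eqn_leq leE -{1}E2.
by apply/forall_inP=> c; rewrite -E2 inE => /andP[].
Qed.

End Trees.
(** * Contracting a side of the polygon, and splitting a vertex *)

(** Linear arithmetic after a case split on every test of the goal, innermost
    tests first so that each case is described by an arithmetic condition. *)
Ltac lia_cases :=
  repeat match goal with
  | |- context [if ?b then _ else _] =>
      lazymatch b with
      | context [if _ then _ else _] => fail
      | context [nat_of_bool _] => fail
      | _ => have [?|?] := boolP b; cbn [nat_of_bool]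
      end
  | |- context [nat_of_bool ?b] =>
      lazymatch b with
      | context [if _ then _ else _] => fail
      | context [nat_of_bool _] => fail
      | _ => have [?|?] := boolP b; cbn [nat_of_bool]
      end
  end; lia.

Section Contraction.
Variable n : nat.
Implicit Types (j : 'I_n.+2) (D : chords n) (G : chords n.+1).
Implicit Types (P : pred {set 'I_n.+1}).

(** The chord parallel to side j. The index j = n+1 stands for the side from
    vertex n+1 back to vertex 0, so that all sides are treated alike. *)
Definition edge j : {set 'I_n.+2} := [set j; ordS j].

(** Side j is contracted to the vertex [pinch j]. The increasing map [lift j] is a
    section of the contraction [shrink j]: it takes [pinch j] to the end of side
    j and misses its start. *)
Definition pinch j : 'I_n.+1 := inord (j %% n.+1).

Definition shrink j (w : 'I_n.+2) : 'I_n.+1 := inord ((w - (j < w)) %% n.+1).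

(** The other sections take [pinch j] to the start of side j; the boolean tells
    which copy of the split vertex is meant. *)
Definition unshrink j (b : bool) (u : 'I_n.+1) : 'I_n.+2 :=
  if (u == pinch j) && b then j else lift j u.

Definition contraction j G : chords n :=
  [set shrink j @: d | d : {set 'I_n.+2} in G :\ edge j].

(** Splitting the vertex [pinch j] of D: the chords in P are attached to its first
    copy, the others to the second. *)
Definition expand j P D : chords n.+1 :=
  edge j |: [set unshrink j (P d) @: d | d : {set 'I_n.+1} in D].

Lemma val_pinch j : pinch j = (if j == n.+1 :> nat then 0 else j)%N :> nat.
Proof.
rewrite inordK ?ltn_pmod //; case: eqP => [->|]; first exact: modnn.
by have := ltn_ord j => *; rewrite modn_small //; lia.
Qed.

Lemma val_ordS j : ordS j = (if j == n.+1 :> nat then 0 else j.+1)%N :> nat.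
Proof.
rewrite /=; case: eqP => [->|]; first exact: modnn.
by have := ltn_ord j => *; rewrite modn_small //; lia.
Qed.

Lemma val_shrink j w : shrink j w =
  (if (w == n.+1 :> nat) && (j == n.+1 :> nat) then 0 else w - (j < w))%N :> nat.
Proof.
have := ltn_ord j; have := ltn_ord w; rewrite inordK ?ltn_pmod // => wn jn.
case: andP => [[/eqP-> /eqP->]|ne]; first by rewrite ltnn subn0 modnn.
by rewrite modn_small //; case: ltnP; lia.
Qed.

Lemma val_lift j (u : 'I_n.+1) : lift j u = (u + (j <= u))%N :> nat.
Proof. by rewrite /= /bump addnC. Qed.

Lemma lift_pinch j : lift j (pinch j) = ordS j.
Proof.
apply: ord_inj; rewrite [LHS]val_lift [RHS]val_ordS val_pinch.
by case: eqP => [->|_] //; rewrite leqnn addn1.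
Qed.

Lemma shrink_lift j u : shrink j (lift j u) = u.
Proof.
apply: ord_inj; rewrite [LHS]val_shrink val_lift.
by have := ltn_ord u; have := ltn_ord j; lia_cases.
Qed.

Lemma shrink_self j : shrink j j = pinch j.
Proof.
by apply: ord_inj; rewrite [LHS]val_shrink [RHS]val_pinch ltnn subn0 andbb.
Qed.

Lemma shrink_ordS j : shrink j (ordS j) = pinch j.
Proof. by rewrite -lift_pinch shrink_lift. Qed.

Lemma unshrinkK j b : cancel (unshrink j b) (shrink j).
Proof.
move=> u; rewrite /unshrink; case: andP => [[/eqP-> _]|_].
  exact: shrink_self.
exact: shrink_lift.
Qed.

Lemma shrinkK j w : w != j -> lift j (shrink j w) = w.
Proof.
by case: (unliftP j w) => [u ->|->]; rewrite ?shrink_lift // eqxx.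
Qed.

Lemma ordS_neq j : j != ordS j.
Proof. by rewrite -lift_pinch neq_lift. Qed.

Lemma unshrink_self j b u : (unshrink j b u == j) = (u == pinch j) && b.
Proof.
rewrite /unshrink; case: ifP => _; first by rewrite eqxx.
by rewrite eq_sym (negPf (neq_lift _ _)).
Qed.

Lemma unshrink_ordS j b u : (unshrink j b u == ordS j) = (u == pinch j) && ~~ b.
Proof.
rewrite /unshrink -lift_pinch; case: (eqVneq u (pinch j)) => [->|ne] /=; last first.
  by rewrite (inj_eq (@lift_inj _ j)) (negPf ne).
by case: b; rewrite ?eqxx // (negPf (neq_lift _ _)).
Qed.

Lemma shrink_unshrink j b (d : {set 'I_n.+1}) :
  shrink j @: (unshrink j b @: d) = d.
Proof.
rewrite -imset_comp -[RHS]imset_id.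
by apply: eq_imset => u /=; rewrite unshrinkK.
Qed.

Lemma edge_unshrink j b (d : {set 'I_n.+1}) : #|d| = 2%N -> edge j != unshrink j b @: d.
Proof.
move=> d2; apply/eqP=> /(congr1 (fun A : {set _} => shrink j @: A)).
rewrite shrink_unshrink => /(congr1 (fun A : {set _} => #|A|)); rewrite d2.
by rewrite /edge imsetU1 imset_set1 shrink_self shrink_ordS setUid cards1.
Qed.

Lemma expand_setD j P D : pairs D ->
  expand j P D :\ edge j = [set unshrink j (P d) @: d | d : {set 'I_n.+1} in D].
Proof.
move=> /forall_inP pD; apply: setU1K; apply/imsetP => -[d dD /eqP].
by rewrite (negPf (edge_unshrink _ _ (eqP (pD d dD)))).
Qed.

Lemma expandK j P D : pairs D -> contraction j (expand j P D) = D.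
Proof.
move=> pD; rewrite /contraction expand_setD // -imset_comp -[RHS]imset_id.
by apply: eq_imset => d; rewrite /= shrink_unshrink.
Qed.

Lemma edge_expand j P D : edge j \in expand j P D.
Proof. exact: setU11. Qed.

(** Whether an expanded chord belongs to P can be read off its endpoints. *)
Lemma in_expand j P D a b : [set a; b] \in expand j P D ->
  [set a; b] = edge j \/
  let d := [set shrink j a; shrink j b] in
  [/\ d \in D, a == j -> P d, b == j -> P d,
      a == ordS j -> ~~ P d & b == ordS j -> ~~ P d].
Proof.
case/setU1P=> [->|/imsetP[d dD abd]]; [by left | right].
have dE : [set shrink j a; shrink j b] = d.
  by rewrite -(shrink_unshrink j (P d) d) -abd imsetU1 imset_set1.
have inab x : x \in [set a; b] -> (x == j -> P d) /\ (x == ordS j -> ~~ P d).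
  rewrite abd => /imsetP[u _ ->]; rewrite unshrink_self unshrink_ordS.
  by split=> /andP[].
rewrite /= dE; split=> //; try by case: (inab a (set21 _ _)).
all: by case: (inab b (set22 _ _)).
Qed.

(** The place of v in the order in which the other vertices are met from i. *)
Definition turn_pos (i v : nat) : nat :=
  if (v < i)%N then (i - v.+1)%N else (i + n - v)%N.

(** The condition under which the chords at i can be attached to two consecutive
    copies of i, those of P to the first, without crossing one another. *)
Definition fan_initial (i : 'I_n.+1) P D : Prop :=
  forall v w, [set i; v] \in D -> [set i; w] \in D ->
    P [set i; w] -> ~~ P [set i; v] -> (turn_pos i w < turn_pos i v)%N.

Lemma edge_consec j (a b : 'I_n.+2) : (a < b)%N -> [set a; b] = edge j ->
  (b = a.+1 :> nat) \/ (a = 0%N :> nat) /\ (b = n.+1 :> nat).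
Proof.
move=> ab /set2_eqP eq; move: ab (ltn_ord j).
by case: eq => -[-> ->]; rewrite !val_ordS; lia_cases.
Qed.

Lemma edge_uncrossed j (a b a' b' : 'I_n.+2) :
  (a < a')%N -> (a' < b)%N -> (b < b')%N ->
  [set a; b] <> edge j /\ [set a'; b'] <> edge j.
Proof.
move=> aa' a'b bb'; have := ltn_ord b'.
split=> eq.
  by case: (edge_consec (ltn_trans aa' a'b) eq); lia.
by case: (edge_consec (ltn_trans a'b bb') eq); lia.
Qed.

(** Contraction weakly preserves the cyclic order. So if the four endpoints of a
    crossing contract to endpoints of chords that do not cross, then two
    cyclically consecutive ones are the two copies of the split vertex, and these
    two chords are in the wrong order in the fan. Stated for natural numbers, with
    q, r and sh for [pinch j], [ordS j] and [shrink j]. *)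
Lemma crossing_shrink (j a b a' b' : nat) :
  let q := if j == n.+1 then 0%N else j in
  let r := if j == n.+1 then 0%N else j.+1 in
  let sh w := if (w == n.+1) && (j == n.+1) then 0%N else (w - (j < w))%N in
  (j < n.+2)%N -> (b' < n.+2)%N -> (a < a')%N -> (a' < b)%N -> (b < b')%N ->
  ~~ ((sh a < sh a')%N && (sh a' < sh b)%N && (sh b < sh b')%N) ->
  ~~ ((sh b' < sh a)%N && (sh a < sh a')%N && (sh a' < sh b)%N) ->
  (a = j -> a' = r -> (turn_pos q (sh b) < turn_pos q (sh b'))%N) ->
  (a' = j -> b = r -> (turn_pos q (sh b') < turn_pos q (sh a))%N) ->
  (b = j -> b' = r -> (turn_pos q (sh a) < turn_pos q (sh a'))%N) ->
  (b' = j -> a = r -> (turn_pos q (sh a') < turn_pos q (sh b))%N) ->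
  False.
Proof.
move=> q r sh jn b'n aa' a'b bb' nx1 nx2; rewrite /turn_pos.
move: nx1 nx2; rewrite /q /r /sh {q r sh}.
case: (eqVneq j n.+1) => [jE|jn'].
  have [-> -> ->] :
      [/\ (a == n.+1) = false, (b == n.+1) = false & (a' == n.+1) = false].
    by split; lia.
  have [-> -> -> ->] :
      [/\ (j < a)%N = false, (j < b)%N = false,
          (j < a')%N = false & (j < b')%N = false].
    by split; lia.
  rewrite /= !subn0 andbT; case: eqP => [b'E|b'E] nx1 nx2 _ _ _; last by lia.
  have a0 : a = 0%N by lia.
  by move=> /(_ (etrans b'E (esym jE)) a0); lia.
rewrite !andbF => nx1 _.
have [[aj a'j]|[[a'j bj]|[bj b'j]]] :
    (a = j /\ a' = j.+1) \/ (a' = j /\ b = j.+1) \/ (b = j /\ b' = j.+1).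
- by move: nx1; lia_cases.
- move=> /(_ aj a'j) + _ _ _; clear nx1.
  have [-> ->] : (j < b)%N /\ (j < b')%N by split; lia.
  by rewrite !ifN; lia.
- move=> _ /(_ a'j bj) + _ _; clear nx1.
  have [-> ->] : (j < b')%N /\ (j < a)%N = false by split; lia.
  by rewrite ifN ?ifT; lia.
- move=> _ _ /(_ bj b'j) + _; clear nx1.
  have [-> ->] : (j < a)%N = false /\ (j < a')%N = false by split; lia.
  by rewrite !ifT; lia.
Qed.

Lemma expand_noncrossing j P D :
  noncrossing D -> fan_initial (pinch j) P D -> noncrossing (expand j P D).
Proof.
move=> /noncrossingP nD iP; apply/noncrossingP => a b a' b' abE abE'.
apply/negP=> /andP[/andP[aa' a'b] bb'].
have [ne ne'] := edge_uncrossed j aa' a'b bb'.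
have [//|/= [dD ja jb sa sb]] := in_expand abE.
have [//|/= [dD' ja' jb' sa' sb']] := in_expand abE'.
have nx1 := nD _ _ _ _ dD dD'.
have nx2 := nD (shrink j b') (shrink j a') (shrink j a) (shrink j b).
rewrite [[set shrink j b'; _]]setUC in nx2; have {}nx2 := nx2 dD' dD.
(* Chords through the two copies of the split vertex are compared by the order
   of the fan. *)
have conflict x y x' y' d d' : d \in D -> d' \in D ->
    d = [set shrink j x; shrink j y] -> d' = [set shrink j x'; shrink j y'] ->
    (x == j -> P d) -> (x' == ordS j -> ~~ P d') ->
    x = j :> nat -> x' = ordS j :> nat ->
    (turn_pos (pinch j) (shrink j y) < turn_pos (pinch j) (shrink j y'))%N.
  move=> dD1 dD2 d1 d2 + + /ord_inj xj /ord_inj xj'.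
  move: dD1 dD2; rewrite {}d1 {}d2 xj xj' !eqxx shrink_self shrink_ordS.
  by move=> dD1 dD2 /(_ isT) Pd /(_ isT) Pd'; apply: iP.
have := conflict b' a' a b _ _ dD' dD (setUC _ _) erefl jb' sa.
have := conflict b a b' a' _ _ dD dD' (setUC _ _) (setUC _ _) jb sb'.
have := conflict a' b' b a _ _ dD' dD erefl (setUC _ _) ja' sb.
have := conflict a b a' b' _ _ dD dD' erefl erefl ja sa'.
move: nx1 nx2; rewrite !val_ordS !val_shrink val_pinch.
exact: crossing_shrink.
Qed.
End Contraction.
Section Expansion.
Variable n : nat.
Implicit Types (j : 'I_n.+2) (D : chords n) (G : chords n.+1).
Implicit Types (P : pred {set 'I_n.+1}).

Lemma edge_adjacent j G : edge j \in G -> adjacent G j (ordS j).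
Proof. by move=> jG; rewrite /adjacent ordS_neq. Qed.

(** The two copies of a vertex are joined by the new chord, so that a walk in D
    lifts to a walk in its expansion. *)
Lemma connect_copies j G b u : edge j \in G ->
  connect (adjacent G) (unshrink j b u) (lift j u).
Proof.
rewrite /unshrink => /edge_adjacent jG; case: ifP => // /andP[/eqP-> _].
by rewrite lift_pinch connect1.
Qed.

Lemma expand_connected j P D : connected D -> connected (expand j P D).
Proof.
move=> cD; set G := expand j P D; have jG : edge j \in G := edge_expand j P D.
have lift_conn w : connect (adjacent G) w (lift j (shrink j w)).
  have [->|wj] := eqVneq w j; last by rewrite shrinkK.
  by rewrite shrink_self lift_pinch connect1 // edge_adjacent.
have lift_edge u v : connect (adjacent D) u v ->
    connect (adjacent G) (lift j u) (lift j v).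
  case/connectP=> p; elim: p u => [|w p IHp] u /= => [_ -> // | /andP[uw pw] lv].
  apply: connect_trans (IHp _ pw lv); have [uwn uwD] := andP uw.
  set b := P [set u; w].
  rewrite connect_adjC (connect_trans _ (connect_copies b u jG)) //.
  rewrite connect_adjC (connect_trans _ (connect_copies b w jG)) //.
  apply: connect1; rewrite /adjacent (can_eq (@unshrinkK _ _ _)) uwn inE.
  apply/orP; right; apply/imsetP; exists [set u; w] => //.
  by rewrite imsetU1 imset_set1.
move=> x y; apply: connect_trans (lift_conn x) _; rewrite connect_adjC.
apply: connect_trans (lift_conn y) _; exact: lift_edge.
Qed.

Lemma expand_diagram j P D : is_diagram D -> fan_initial (pinch j) P D ->
  is_diagram (expand j P D).
Proof.
move=> dD iP; have [cD _ nD _] := is_diagramP _ dD.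
apply: connected_diagram; last exact: expand_noncrossing.
  exact/expand_connected/diagram_connected.
apply: leq_trans (leq_card_setU _ _) _; rewrite cards1 ltnS.
by rewrite (leq_trans (leq_imset_card _ _)) ?cD.
Qed.

(** Conversely, if the chords {j, w} and {r, v} at the two copies of the split
    vertex do not cross, then w comes before v in the order of the fan. *)
Lemma crossing_copies (j w v : nat) :
  let q := if j == n.+1 then 0%N else j in
  let r := if j == n.+1 then 0%N else j.+1 in
  let sh x := if (x == n.+1) && (j == n.+1) then 0%N else (x - (j < x))%N in
  (j < n.+2)%N -> (v < n.+2)%N -> (w < n.+2)%N ->
  v != j -> v != r -> w != j -> w != r -> v != w ->
  ~~ ((w < v)%N && (v < j)%N && (j < r)%N) ->
  ~~ ((v < j)%N && (j < r)%N && (r < w)%N) ->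
  ~~ ((j < r)%N && (r < w)%N && (w < v)%N) ->
  ~~ ((r < w)%N && (w < v)%N && (v < j)%N) ->
  (turn_pos n q (sh w) < turn_pos n q (sh v))%N.
Proof.
move=> q r sh; rewrite /q /r /sh /turn_pos {q r sh}.
have [jE|jn'] := eqVneq j n.+1 => jn vn wn vj vr wj wr vw.
  rewrite jE in vj wj *; rewrite (negPf vj) (negPf wj) /= => _ _ _.
  have [-> ->] : (n.+1 < v)%N = false /\ (n.+1 < w)%N = false by split; lia.
  lia.
rewrite !andbF => h1 h2 h3 _.
have [jv|vj'] := ltnP j v; have [jw|wj'] := ltnP j w.
- by rewrite !ifN; lia.
- by rewrite ifT ?ifN; lia.
- lia.
- by rewrite !ifT; lia.
Qed.

(** Contracting a chord of a tree identifies no two other chords, by counting, so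
    every chord of D has one lift; P tells which lifts end at the first copy of
    the pinched vertex, and precedes its complement since G has no crossing. *)
Lemma contraction_expand j G D : is_diagram G -> is_diagram D ->
  edge j \in G -> contraction j G = D ->
  exists2 P, fan_initial (pinch j) P D & G = expand j P D.
Proof.
move=> dG dD jG GD; have [cG pG /noncrossingP nG _] := is_diagramP _ dG.
have [cD pD _ _] := is_diagramP _ dD.
have inj : {in G :\ edge j &, injective (fun d : {set _} => shrink j @: d)}.
  apply/imset_injP; apply/eqP; transitivity #|D|; first by rewrite -GD.
  by rewrite cD; move: cG; rewrite (cardsD1 (edge j)) jG add1n => -[->].
pose P := [pred d | [exists c in G :\ edge j, (j \in c) && (shrink j @: c == d)]].
have GE d : d \in G :\ edge j -> d = unshrink j (P (shrink j @: d)) @: (shrink j @: d).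
  move=> dG'; have [dj dinG] := setD1P dG'.
  rewrite -imset_comp -[LHS]imset_id; apply: eq_in_imset => w wd /=.
  have [wj|wj] := eqVneq w j.
    rewrite wj shrink_self /unshrink eqxx /= ifT //.
    by apply/exists_inP; exists d; rewrite // -wj wd eqxx.
  rewrite /unshrink shrinkK //; case: ifP => // /andP[wq].
  case/exists_inP=> c cG' /andP[jc /eqP/(inj _ _ cG' dG') cd].
  have wS : w = ordS j by rewrite -(shrinkK wj) (eqP wq) lift_pinch.
  rewrite cd in jc; case/eqP: dj; apply/esym/eqP.
  rewrite eqEcard subUset !sub1set jc -wS wd.
  by rewrite (eqP (forall_inP pG d dinG)) cards2 ordS_neq.
have Psub d : d \in D -> exists2 c, c \in G :\ edge j & d = shrink j @: c.
  by rewrite -GD => /imsetP[c]; exists c.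
exists P; last first.
  apply/eqP; rewrite eqEcard; apply/andP; split.
    apply/subsetP=> d dinG; have [->|dj] := eqVneq d (edge j).
      exact: edge_expand.
    have dG' : d \in G :\ edge j by rewrite !inE dj.
    rewrite /expand inE; apply/orP; right; apply/imsetP.
    by exists (shrink j @: d); rewrite -?GE // -GD; apply: imset_f.
  apply: leq_trans (leq_card_setU _ _) _; rewrite cards1 cG ltnS.
  by rewrite (leq_trans (leq_imset_card _ _)) ?cD.
have neq_base u : [set pinch j; u] \in D -> u != pinch j.
  by move/(forall_inP pD); rewrite cards2 [u == _]eq_sym; case: (_ != _).
have lifted u b : [set pinch j; u] \in D -> P [set pinch j; u] = b ->
    [set (if b then j else ordS j); lift j u] \in G.
  move=> uD Pu; have [c cG' cu] := Psub _ uD; have [_ cG0] := setD1P cG'.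
  suff <- : c = [set (if b then j else ordS j); lift j u] by [].
  rewrite (GE c cG') -cu Pu imsetU1 imset_set1 /unshrink eqxx /=.
  by rewrite (negPf (neq_base _ uD)) -lift_pinch.
have far u : [set pinch j; u] \in D ->
    (lift j u != j :> nat) && (lift j u != ordS j :> nat).
  move=> /neq_base uq; rewrite -lift_pinch !(inj_eq (@ord_inj _)).
  by rewrite eq_sym neq_lift (inj_eq (@lift_inj _ j)).
move=> v w vD wD Pw Pv; have [/andP[vj vS] /andP[wj wS]] := (far v vD, far w wD).
have vw : lift j v != lift j w :> nat.
  rewrite (inj_eq (@ord_inj _)) (inj_eq (@lift_inj _ j)).
  by apply: contraNneq Pv => ->.
have [wG vG] := (lifted w true wD Pw, lifted v false vD (negPf Pv)).
have [Gw Gv] := (wG, vG); rewrite setUC in Gw; rewrite setUC in Gv.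
rewrite -(shrink_lift j v) -(shrink_lift j w) !val_shrink val_pinch.
move: vj vS wj wS (nG _ _ _ _ Gw Gv) (nG _ _ _ _ Gv wG)
  (nG _ _ _ _ wG vG) (nG _ _ _ _ vG Gw).
rewrite !val_ordS => *; apply: crossing_copies => //.
Qed.

End Expansion.
(** * The fan of chords at a vertex *)

Section Fans.
Variable n : nat.
Implicit Types (D : chords n) (i v w : 'I_n.+1) (P : pred {set 'I_n.+1}).

Definition turn_lt i : rel 'I_n.+1 :=
  fun v w => (turn_pos n i v < turn_pos n i w)%N.

Lemma turn_lt_trans i : transitive (turn_lt i).
Proof. by move=> b a c; exact: ltn_trans. Qed.

Lemma mem_take_enum i v : (v \in take i (enum 'I_n.+1)) = (v < i)%N.
Proof. by rewrite in_take ?mem_enum // index_enum_ord. Qed.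

Lemma mem_drop_enum k v : (v \in drop k (enum 'I_n.+1)) = (k <= v)%N.
Proof.
have := enum_uniq 'I_n.+1; rewrite -{1}(cat_take_drop k (enum _)) cat_uniq.
case/and3P=> _ /hasPn dis _; have := mem_enum 'I_n.+1 v.
rewrite -{1}(cat_take_drop k (enum _)) mem_cat in_take ?mem_enum // index_enum_ord.
case: ltnP => //= vk _; apply/negP=> /dis.
by rewrite in_take ?mem_enum // index_enum_ord vk.
Qed.

Lemma mem_turn i v : (v \in turn i) = (v != i).
Proof.
rewrite mem_cat !mem_rev mem_take_enum mem_drop_enum -(inj_eq (@ord_inj _)).
by rewrite neq_ltn.
Qed.

Lemma turn_pairwise i : pairwise (turn_lt i) (turn i).
Proof.
have se : sorted (fun v w : 'I_n.+1 => (v < w)%N) (enum 'I_n.+1).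
  have := iota_ltn_sorted 0 n.+1; rewrite -val_enum_ord sorted_map.
  by apply: sub_sorted.
have tr : transitive (fun v w : 'I_n.+1 => (v < w)%N) by move=> b a c; exact: ltn_trans.
have pr (s : seq 'I_n.+1) : sorted (fun v w : 'I_n.+1 => (v < w)%N) s ->
    {in s &, forall v w, (v < w)%N -> turn_lt i w v} -> sorted (turn_lt i) (rev s).
  move=> ss sub; rewrite rev_sorted.
  by apply: (@sub_in_sorted _ [in s] _ _ _ s (introT allP _) ss).
rewrite /turn pairwise_cat; apply/and3P; split.
- apply/allrelP=> v w; rewrite !mem_rev mem_take_enum mem_drop_enum.
  by have := ltn_ord w; rewrite /turn_lt /turn_pos => ? ? ?; lia_cases.
- rewrite -sorted_pairwise; last exact: turn_lt_trans.
  apply: pr; first exact: take_sorted.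
  move=> v w; rewrite !mem_take_enum /turn_lt /turn_pos => vi wi vw.
  by rewrite vi wi; lia.
- rewrite -sorted_pairwise; last exact: turn_lt_trans.
  apply: pr; first exact: drop_sorted.
  move=> v w; rewrite !mem_drop_enum /turn_lt /turn_pos => ? ? ?.
  by have := ltn_ord w; lia_cases.
Qed.

Definition neighbours D i := [seq v <- turn i | [set i; v] \in D].

Lemma fanE D i : fan D i = [seq [set i; v] | v <- neighbours D i].
Proof. by rewrite /fan filter_map. Qed.

Lemma neighbours_pairwise D i : pairwise (turn_lt i) (neighbours D i).
Proof. exact/pairwise_filter/turn_pairwise. Qed.

Lemma neighbours_uniq D i : uniq (neighbours D i).
Proof.
by apply: pairwise_uniq (neighbours_pairwise D i) => v; rewrite /turn_lt ltnn.
Qed.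

Lemma fan_uniq D i : uniq (fan D i).
Proof. by rewrite fanE map_inj_uniq ?neighbours_uniq //; apply: set2_inj. Qed.

Lemma pair_at D i d : pairs D -> d \in D -> i \in d ->
  exists2 v, v != i & d = [set i; v].
Proof.
move=> pD dD; have [a [b [ab ->]]] := pairsP _ pD d dD.
case/set2P=> ->; first by exists b; rewrite // eq_sym.
by exists a; rewrite // setUC.
Qed.

Lemma mem_neighbours D i v : pairs D ->
  (v \in neighbours D i) = ([set i; v] \in D).
Proof.
move=> pD; rewrite mem_filter mem_turn; case ivD: (_ \in D) => //=.
have := forall_inP pD _ ivD; rewrite cards2 [v == i]eq_sym; by case: (_ != _).
Qed.

Lemma mem_fan D i d : pairs D -> (d \in fan D i) = (d \in D) && (i \in d).
Proof.
move=> pD; rewrite fanE; apply/mapP/andP => [[v]|[dD /(pair_at pD dD)[v _ dv]]].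
  by rewrite mem_neighbours // => ivD ->; rewrite ivD set21.
by exists v; rewrite // mem_neighbours // -dv.
Qed.

Lemma size_fan D i : pairs D -> size (fan D i) = fertility D i.
Proof.
move=> pD; rewrite -(card_uniqP (fan_uniq D i)); apply: eq_card => d.
by rewrite mem_fan // inE.
Qed.

Lemma mem_take_fan D i t v :
  ([set i; v] \in take t (fan D i)) = (v \in take t (neighbours D i)).
Proof. by rewrite fanE -map_take (mem_map (@set2_inj n i)). Qed.

Lemma take_fan_initial D i t : pairs D ->
  fan_initial i [pred d | d \in take t (fan D i)] D.
Proof.
move=> pD v w vD wD /=; rewrite !mem_take_fan => wt vt.
have := neighbours_pairwise D i; rewrite -{1}(cat_take_drop t (neighbours D i)).
rewrite pairwise_cat => /andP[/allrelP/(_ w v wt) lt _]; apply: lt.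
have : v \in neighbours D i by rewrite mem_neighbours.
by rewrite -{1}(cat_take_drop t (neighbours D i)) mem_cat (negPf vt).
Qed.

(** By induction: if p fails on the first item of s, then it fails on all. *)
Lemma prefix_count (T : eqType) (r : rel T) (p : pred T) (s : seq T) :
    irreflexive r -> transitive r -> pairwise r s ->
    {in s &, forall x y, p y -> ~~ p x -> r y x} ->
  {in s, forall x, p x = (x \in take (count p s) s)}.
Proof.
move=> irr tr; elim: s => //= x s IHs /andP[/allP xs ps] pre z.
case px: (p x).
  rewrite add1n /= !inE; have [->|zx] //= := eqVneq z x; move=> zs.
  by apply: IHs => // a b as_ bs; apply: pre; rewrite inE ?as_ ?bs orbT.
have np y : y \in s -> ~~ p y.
  move=> ys; apply/negP=> py.
  have yx : r y x by apply: pre; rewrite ?inE ?eqxx ?ys ?orbT ?px.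
  by have := tr _ _ _ yx (xs y ys); rewrite irr.
have -> : count p s = 0%N by apply/eqP; rewrite -leqn0 leqNgt -has_count; apply/hasPn.
rewrite inE => /orP[/eqP->|/np/negPf->] //; by rewrite px.
Qed.

Lemma fan_prefix i P D : pairs D -> fan_initial i P D ->
  exists2 t, (t <= fertility D i)%N &
    forall d, d \in D -> i \in d -> P d = (d \in take t (fan D i)).
Proof.
move=> pD iP; pose p v := P [set i; v]; exists (count p (neighbours D i)).
  by rewrite -size_fan // fanE size_map count_size.
move=> d dD /(pair_at pD dD)[v _ dv]; rewrite dv mem_take_fan.
apply: (@prefix_count _ (turn_lt i) p).
- by move=> u; rewrite /turn_lt ltnn.
- exact: turn_lt_trans.
- exact: neighbours_pairwise.
- by move=> a b; rewrite !mem_neighbours //; apply: iP.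
by rewrite mem_neighbours // -dv.
Qed.

Lemma take_fan_inj D i t t' : (t <= fertility D i)%N -> (t' <= fertility D i)%N ->
    pairs D ->
    (forall d, d \in D -> i \in d ->
       (d \in take t (fan D i)) = (d \in take t' (fan D i))) ->
  t = t'.
Proof.
move=> lt lt' pD eqt; rewrite -size_fan // in lt lt'.
rewrite -(size_takel lt) -(size_takel lt'); apply/perm_size/uniq_perm.
- exact/take_uniq/fan_uniq.
- exact/take_uniq/fan_uniq.
move=> d; apply/idP/idP => dt.
  by have := mem_take dt; rewrite mem_fan // => /andP[dD di]; rewrite -eqt.
by have := mem_take dt; rewrite mem_fan // => /andP[dD di]; rewrite eqt.
Qed.

End Fans.

Section Fibres.
Variable n : nat.
Implicit Types (j : 'I_n.+2) (D : chords n) (P : pred {set 'I_n.+1}).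

Lemma eq_expand j P P' D :
    (forall d, d \in D -> pinch j \in d -> P d = P' d) ->
  expand j P D = expand j P' D.
Proof.
move=> eqP; congr (_ |: _); apply: eq_in_imset => d dD.
have [/(eqP d dD)-> // | nd] := boolP (pinch j \in d).
apply: eq_in_imset => u ud; rewrite /unshrink.
by have [uq|//] := eqVneq u (pinch j); rewrite -uq ud in nd.
Qed.

Lemma expand_inj j P P' D : pairs D -> expand j P D = expand j P' D ->
  forall d, d \in D -> pinch j \in d -> P d = P' d.
Proof.
move=> pD eqE d dD qd.
have memj Q : (j \in unshrink j (Q d) @: d) = Q d.
  apply/imsetP/idP => [[u _ /esym/eqP]|Qd]; first by rewrite unshrink_self => /andP[].
  by exists (pinch j); rewrite // /unshrink eqxx Qd.
have : unshrink j (P d) @: d \in expand j P D :\ edge j.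
  by rewrite expand_setD //; apply: imset_f.
rewrite eqE expand_setD // => /imsetP[d' _ eqd].
have dd' : d = d' by rewrite -(shrink_unshrink j (P d) d) eqd shrink_unshrink.
by rewrite -(memj P) eqd -dd' memj.
Qed.

Definition expand_fan j t D : chords n.+1 :=
  expand j [pred d | d \in take t (fan D (pinch j))] D.

Lemma expand_fan_inj j D : is_diagram D ->
  injective (fun t : 'I_(fertility D (pinch j)).+1 => expand_fan j t D).
Proof.
move=> /is_diagramP[_ pD _ _] t t' eqE; apply: ord_inj.
by apply: (take_fan_inj (ltn_ord t) (ltn_ord t') pD) (expand_inj pD eqE).
Qed.

(** A tree that contracts to D splits the pinched vertex, and the absence of
    crossings leaves one freedom, the place where the fan is cut in two. *)
Lemma contraction_fibre j D : is_diagram D ->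
  [set G | [&& is_diagram G, edge j \in G & contraction j G == D]] =
  [set expand_fan j t D | t : 'I_(fertility D (pinch j)).+1].
Proof.
move=> dD; have [_ pD _ _] := is_diagramP _ dD; apply/setP=> G; rewrite inE.
apply/and3P/imsetP => [[dG jG /eqP GD]|[t _ ->]].
  have [P iP ->] := contraction_expand dG dD jG GD.
  have [t le_t Pt] := fan_prefix pD iP; exists (Ordinal (le_t : t < _.+1)%N) => //.
  exact: eq_expand.
split; [|exact: edge_expand|by rewrite expandK].
exact/expand_diagram/take_fan_initial.
Qed.

End Fibres.
(** * Cutting along one chord *)

Section OneCut.
Variable n : nat.
Implicit Types (G C : chords n) (c d F : {set 'I_n.+1}) (u v w s : 'I_n.+1).

Definition arc u v : {set 'I_n.+1} := [set s : 'I_n.+1 | (u <= s < v)%N].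

(** The contraction of w onto F is this number modulo the number of sides of F.
    Before reduction it is monotone in w, and only its maximum #|F| wraps to 0. *)
Definition sides_below F (w : nat) : nat := #|[set s in F | (s < w)%N]|.

Lemma under_arc u v s : (u < v)%N -> under [set u; v] s = (s \in arc u v).
Proof.
move=> uv; rewrite inE; apply/exists_inP/idP => [[a + /exists_inP[b]]|us].
  by case/set2P=> -> /set2P[->|->] //; lia.
by exists u; rewrite ?set21 //; apply/exists_inP; exists v; rewrite ?set22.
Qed.

Lemma same_face1 c s s' : same_face [set c] s s' = (under c s == under c s').
Proof.
apply/forall_inP/idP=> [/(_ c)|ss c' /set1P-> //]; by apply; rewrite inE.
Qed.

Lemma ord_max_arc u v : ord_max \notin arc u v.
Proof. by rewrite inE; have := ltn_ord v; rewrite /=; lia. Qed.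

Lemma faces1 u v : (u < v)%N ->
  faces [set [set u; v]] = [set arc u v; ~: arc u v].
Proof.
move=> uv; have fE s : [set s' in [set: 'I_n.+1] | same_face [set [set u; v]] s s'] =
    if s \in arc u v then arc u v else ~: arc u v.
  apply/setP=> s'; rewrite !inE same_face1 !under_arc //.
  by case: ifP => h; rewrite !inE in h *; rewrite h; case: (_ <= _ < _)%N.
apply/setP=> F; rewrite !inE; apply/imsetP/orP => [[s _ ->]|].
  by rewrite fE; case: ifP; rewrite eqxx; auto.
case=> /eqP->; [exists u | exists ord_max]; rewrite ?inE // fE.
  by rewrite inE leqnn uv.
by rewrite (negPf (ord_max_arc u v)).
Qed.

Lemma card_interval a b : (b <= n.+1)%N ->
  #|[set s : 'I_n.+1 | (a <= s < b)%N]| = (b - a)%N.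
Proof.
elim: b => [|b IHb] bn.
  by rewrite sub0n; apply: eq_card0 => s; rewrite inE ltn0 andbF.
have [ab|ba] := leqP a b; last first.
  rewrite (eqP (_ : b.+1 - a == 0)%N) ?subn_eq0 //; apply: eq_card0 => s.
  by rewrite !inE; apply/negbTE; lia.
rewrite subSn // -IHb; last exact: ltnW.
have -> : [set s : 'I_n.+1 | (a <= s < b.+1)%N] =
    inord b |: [set s : 'I_n.+1 | (a <= s < b)%N].
  apply/setP=> s; rewrite !inE -(inj_eq (@ord_inj _)) inordK //.
  by case: eqP => [->|]; rewrite ?ab ?leqnn //=; lia.
by rewrite cardsU1 inE inordK // ltnn andbF.
Qed.

Lemma card_arc u v : #|arc u v| = (v - u)%N.
Proof. by apply: card_interval; rewrite ltnW. Qed.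

Lemma card_arcC u v : #|~: arc u v| = (n.+1 - (v - u))%N.
Proof. by rewrite cardsCs setCK card_ord card_arc. Qed.

Lemma below_arc u v (w : nat) : (w <= n.+1)%N ->
  sides_below (arc u v) w = (minn w v - u)%N.
Proof.
move=> wn; rewrite /sides_below -card_interval; last by rewrite geq_min wn.
by apply: eq_card => s; rewrite !inE leq_min -andbA [(s < w)%N && _]andbC.
Qed.

Lemma below_arcC u v (w : nat) : (w <= n.+1)%N ->
  sides_below (~: arc u v) w = (w - (minn w v - u))%N.
Proof.
move=> wn; rewrite -(below_arc u v wn) /sides_below.
have cw : #|[set s : 'I_n.+1 | (0 <= s < w)%N]| = w by rewrite card_interval ?subn0.
rewrite -[X in (X - _)%N]cw -[X in (X - _)%N](cardsID (arc u v)).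
have -> : [set s : 'I_n.+1 | (0 <= s < w)%N] :&: arc u v =
    [set s in arc u v | (s < w)%N].
  by apply/setP=> s; rewrite !inE andbC.
by rewrite addKn; apply: eq_card => s; rewrite !inE.
Qed.

Lemma below_le F w : (sides_below F w <= #|F|)%N.
Proof. by apply/subset_leq_card/subsetP=> s; rewrite inE => /andP[]. Qed.

Lemma below_mono F w w' : (sides_below F w < sides_below F w')%N -> (w < w')%N.
Proof.
rewrite !ltnNge; apply: contra => ww; apply/subset_leq_card/subsetP=> s.
by rewrite !inE => /andP[-> sw]; apply: leq_trans sw ww.
Qed.

Lemma val_contract F w : (0 < #|F|)%N -> contract F w =
  (if sides_below F w == #|F| then 0 else sides_below F w)%N :> nat.
Proof.
move=> F0; rewrite inordK; last by rewrite prednK ?ltn_pmod.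
rewrite -/(sides_below F w); case: eqP => [->|ne].
  exact: modnn.
by rewrite modn_small // ltn_neqAle below_le andbT; apply/eqP.
Qed.

Lemma contract_eq F w w' : (0 < #|F|)%N ->
  sides_below F w = sides_below F w' %[mod #|F|] -> contract F w = contract F w'.
Proof. by move=> F0 e; rewrite /contract -/(sides_below F w) e. Qed.

(** Contraction onto a face weakly preserves the cyclic order of the vertices, so
    a crossing of images comes from a crossing in G. When the first endpoint
    wraps around, the two crossing chords exchange their roles. *)
Lemma q_face_noncrossing G C F : is_diagram G -> (0 < #|F|)%N ->
  noncrossing (q_face G C F).
Proof.
move=> /is_diagramP[_ pG /noncrossingP nG _] F0.
have preim x y : [set x; y] \in q_face G C F -> exists a b,
    [/\ [set a; b] \in G, [set b; a] \in G, x = contract F a & y = contract F b].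
  case/imsetP=> d; rewrite inE => /andP[/setDP[dG _] _].
  have [a [b [_ dab]]] := pairsP _ pG d dG; rewrite dab imsetU1 imset_set1.
  case/set2_eqP=> -[-> ->]; first by exists a, b; rewrite [[set b; a]]setUC -dab.
  by exists b, a; rewrite [[set b; a]]setUC -dab.
apply/noncrossingP=> x y x' y' /preim[a [b [G1 G2 -> ->]]].
case/preim=> [a' [b' [G1' G2' -> ->]]].
apply/negP=> /andP[/andP[]]; rewrite !val_contract //.
have := nG _ _ _ _ G1 G1'; have := nG _ _ _ _ G1' G2.
have := @below_mono F a a'; have := @below_mono F a' b.
have := @below_mono F b b'; have := @below_mono F b' a.
have := below_le F a; have := below_le F b.
have := below_le F a'; have := below_le F b'.
move: (sides_below F a) (sides_below F b) (sides_below F a') (sides_below F b').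
move=> ga gb ga' gb' ? ? ? ? m1 m2 m3 m4 x1 x2 e1 e2 e3.
have ltF g g' : (g < (if g' == #|F| then 0 else g'))%N -> g' != #|F|.
  by case: eqP => // _; rewrite ltn0.
have [nb' nb na'] := And3 (ltF _ _ e3) (ltF _ _ e2) (ltF _ _ e1).
rewrite (negPf nb') (negPf nb) (negPf na') in e1 e2 e3.
move: e1; case: eqP => [gaF _|_ e1].
  by case/negP: x1; rewrite (m3 e2) (m2 e3) m1 // gaF ltn_neqAle nb'.
by case/negP: x2; rewrite (m4 e1) (m3 e2) (m2 e3).
Qed.

(** Contraction onto a face F maps a walk of G to a walk of the contracted
    diagram, as soon as every chord of G is either carried by F or contracted
    to a point. *)
Lemma q_face_connected G c F : is_diagram G -> (0 < #|F|)%N ->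
    (forall k, (k < #|F|)%N -> exists w : 'I_n.+1, sides_below F w = k) ->
    (forall a b, [set a; b] \in G ->
       sides_below F a = sides_below F b %[mod #|F|] \/
       [set a; b] != c /\ lies_in [set c] F [set a; b]) ->
  connected (q_face G [set c] F).
Proof.
move=> dG F0 onto carry x y.
have preim (z : 'I_#|F|.-1.+1) : exists w, z = contract F w.
  have zF : (z < #|F|)%N by rewrite -{2}(prednK F0) ltn_ord.
  have [w wz] := onto z zF; exists w; apply: ord_inj.
  by rewrite val_contract // wz ltn_eqF.
have [[w ->] [w' ->]] := (preim x, preim y).
case/connectP: (diagram_connected dG w w') => p.
elim: p w => [|z p IHp] w /= => [_ -> // | /andP[wz pz] lw'].
apply: connect_trans (IHp _ pz lw'); have [wzn wzG] := andP wz.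
have [/(contract_eq F0)-> //|[ne lie]] := carry w z wzG.
have [-> //|cne] := eqVneq (contract F w) (contract F z).
apply: connect1; rewrite /adjacent cne; apply/imsetP; exists [set w; z].
  by rewrite !inE ne wzG.
by rewrite imsetU1 imset_set1.
Qed.

Section Cut.
Variables (G : chords n) (u v : 'I_n.+1).
Hypotheses (dG : is_diagram G) (uv : (u < v)%N) (cG : [set u; v] \in G).
Let c := [set u; v].

Lemma chord_side a b : [set a; b] \in G ->
  ((u <= a <= v) && (u <= b <= v))%N \/
  ((a <= u) || (v <= a))%N && ((b <= u) || (v <= b))%N.
Proof.
move=> abG; have [_ _ /noncrossingP nG _] := is_diagramP _ dG.
have baG : [set b; a] \in G by rewrite setUC.
have := nG _ _ _ _ abG cG; have := nG _ _ _ _ baG cG.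
have := nG _ _ _ _ cG abG; have := nG _ _ _ _ cG baG.
clear - uv; lia.
Qed.

Lemma lies_inP F b (d : {set 'I_n.+1}) :
    (forall s, s \in F -> (s \in arc u v) = b) ->
    (forall w, w \in d -> w != u -> w != v -> (w \in arc u v) = b) ->
  lies_in [set c] F d.
Proof.
move=> Fb db; apply/forall_inP=> c' /set1P->.
apply/forall_inP=> s sF; apply/forall_inP=> w wd.
rewrite !inE negb_or; apply/implyP=> /andP[wu wv].
by rewrite !under_arc // (Fb s sF) db.
Qed.

Lemma lies_in_under F (d : {set 'I_n.+1}) s w : lies_in [set c] F d ->
  s \in F -> w \in d -> w \notin c -> (w \in arc u v) = (s \in arc u v).
Proof.
move=> /forall_inP/(_ c (set11 c))/forall_inP lie sF wd wc.
have /forall_inP/(_ w wd)/implyP/(_ wc)/eqP := lie s sF.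
by rewrite !under_arc.
Qed.

Lemma arc_gt0 : (0 < #|arc u v|)%N.
Proof. by rewrite card_arc subn_gt0. Qed.

Lemma arcC_gt0 : (0 < #|~: arc u v|)%N.
Proof. by rewrite card_arcC subn_gt0; have := ltn_ord v; lia. Qed.

Lemma q_arc_connected : connected (q_face G [set c] (arc u v)).
Proof.
apply: q_face_connected arc_gt0 _ _ => // [k | a b abG].
  rewrite card_arc => ku; have := ltn_ord v => vn.
  have ukn : (u + k < n.+1)%N by lia.
  exists (Ordinal ukn); rewrite below_arc /=; last exact: ltnW.
  by rewrite /minn ifT; lia.
have out_eq (z : 'I_n.+1) : ((z <= u) || (v <= z))%N ->
    (sides_below (arc u v) z %% #|arc u v| = 0)%N.
  rewrite below_arc ?card_arc; last exact: ltnW.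
  case/orP=> zuv; last by rewrite (minn_idPr zuv) modnn.
  by rewrite (eqP (_ : minn z v - u == 0)%N) ?mod0n //; lia.
have [abc|ne] := eqVneq [set a; b] c.
  by left; case/set2_eqP: abc => -[-> ->]; rewrite !out_eq ?leqnn ?orbT.
case: (chord_side abG) => /andP[az bz]; last by left; rewrite !out_eq.
right; split=> //; apply: (@lies_inP _ true) => // w wab wu wv.
have : (u <= w <= v)%N by case/set2P: wab => ->.
rewrite -(inj_eq (@ord_inj _)) in wv; rewrite inE; lia.
Qed.

Lemma q_arcC_connected : connected (q_face G [set c] (~: arc u v)).
Proof.
have ltvn := ltn_ord v.
apply: q_face_connected arcC_gt0 _ _ => // [k | a b abG].
  rewrite card_arcC => ku; have [ku'|uk] := leqP k u.
    have kn : (k < n.+1)%N by lia.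
    by exists (Ordinal kn); rewrite below_arcC /=; lia.
  have kn : (k + (v - u) < n.+1)%N by lia.
  by exists (Ordinal kn); rewrite below_arcC /=; lia.
have in_eq (z : 'I_n.+1) : ((u <= z) && (z <= v))%N ->
    (sides_below (~: arc u v) z = u :> nat)%N.
  by rewrite below_arcC; [lia | exact: ltnW].
have [abc|ne] := eqVneq [set a; b] c.
  by left; case/set2_eqP: abc => -[-> ->]; rewrite !in_eq ?leqnn ?(ltnW uv).
case: (chord_side abG) => /andP[az bz]; first by left; rewrite !in_eq.
right; split=> //; apply: (@lies_inP _ false) => [s|w wab wu wv].
  by rewrite in_setC => /negPf.
have : ((w <= u) || (v <= w))%N by case/set2P: wab => ->.
rewrite -(inj_eq (@ord_inj _)) in wu; rewrite inE => ?; apply/negbTE; lia.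
Qed.

(** Cutting along a chord leaves a tree in each of the two faces: both are
    connected, and together they have one chord less than G. *)
Lemma q_face_diagrams : is_diagram (q_face G [set c] (arc u v)) /\
  is_diagram (q_face G [set c] (~: arc u v)).
Proof.
have [cdG pG _ _] := is_diagramP _ dG.
pose S F := [set d in G :\: [set c] | lies_in [set c] F d].
have leS F : (#|q_face G [set c] F| <= #|S F|)%N.
  have -> : q_face G [set c] F = [set contract F @: d | d : {set 'I_n.+1} in S F].
    apply/setP=> x; apply/imsetP/imsetP=> -[d dS ->]; exists d;
      by move: dS; rewrite ?inE.
  exact: leq_imset_card.
have disS : [disjoint S (arc u v) & S (~: arc u v)].
  rewrite -setI_eq0; apply/eqP/setP=> d; rewrite !inE; apply/negbTE/negP.
  case/andP=> /andP[/andP[dc dG'] la] /andP[_ lC].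
  have sub : d \subset c.
    apply/subsetP=> w wd; apply/negPn/negP=> wc.
    have ua : u \in arc u v by rewrite inE leqnn.
    have := lies_in_under la ua wd wc; rewrite ua => wa.
    have maxC : ord_max \in ~: arc u v by rewrite in_setC ord_max_arc.
    have := lies_in_under lC maxC wd wc.
    by rewrite wa (negPf (ord_max_arc u v)).
  case/negP: dc; rewrite eqEcard sub (eqP (forall_inP pG _ cG)).
  by rewrite (eqP (forall_inP pG _ dG')).
have leSS : (#|S (arc u v)| + #|S (~: arc u v)| < n)%N.
  rewrite -cardsUI (eqP (_ : _ :&: _ == set0)) ?setI_eq0 // cards0 addn0.
  have cG1 : #|G :\ c|.+1 = n by rewrite -[RHS]cdG (cardsD1 c G) cG.
  apply: leq_trans (eq_leq cG1); rewrite ltnS; apply/subset_leq_card/subsetP=> d.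
  by rewrite !inE => /orP[]/andP[].
have [cA cC] := (q_arc_connected, q_arcC_connected).
have geF F : connected (q_face G [set c] F) -> (#|F|.-1 <= #|q_face G [set c] F|)%N.
  move/connected_card/leq_trans; apply; apply/subset_leq_card/subsetP=> d.
  by rewrite inE => /andP[].
have kk : (#|arc u v| + #|~: arc u v| = n.+1)%N.
  by have := ltn_ord v; rewrite card_arc card_arcC; lia.
have := leS (~: arc u v); have := leS (arc u v).
have := geF _ cC; have := geF _ cA; have := arcC_gt0; have := arc_gt0.
have nonx F := @q_face_noncrossing G [set c] F dG.
have dia F : connected (q_face G [set c] F) -> (0 < #|F|)%N ->
    (#|q_face G [set c] F| <= #|F|.-1)%N -> is_diagram (q_face G [set c] F).
  by move=> cF F0 leF; apply: connected_diagram => //; apply: nonx.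
move=> kA kC gA gC lA lC; split; apply: dia => //;
  clear - kk kA kC gA gC lA lC leSS; lia.
Qed.

End Cut.
End OneCut.
(** * Diagrams as monomials *)

Section Monomials.

Lemma mon_diagram n (D : diagram n) (n_gt0 : (0 < n)%N) :
  mon D = ucm (Sub (mk_any D) n_gt0 : generator).
Proof. by rewrite /mon valK /monD (@insubT _ _ generator (mk_any D) n_gt0). Qed.

Lemma mon_deg0 (E : chords 0) : mon E = mone.
Proof. by rewrite /mon; case: insubP => //= D _ _; rewrite /monD insubF. Qed.

Lemma mdeg_mon n (D : diagram n) : mdeg (mon D) = (0 < n)%N.
Proof.
case: n D => [|n] D; first by rewrite mon_deg0 mdeg1.
by rewrite mon_diagram mdegU.
Qed.

Lemma ucm_inj (I : choiceType) : injective (@ucm I).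
Proof.
by move=> i j eq_ij; have := cmU i j; rewrite eq_ij cmUU; case: eqP.
Qed.

Lemma mon_degree k (E : chords k) n (D : diagram n) :
  (0 < n)%N -> mon E = mon D -> k = n.
Proof.
move=> n0 eqm; have : mdeg (mon E) = 1%N by rewrite eqm mdeg_mon n0.
move: eqm; rewrite [mon E]/mon; case: insubP => [E' _ _|_ _]; last by rewrite mdeg1.
rewrite -/(mon D) (mon_diagram D n0) /monD; case: insubP => [g _ gE|_ _];
  last by rewrite mdeg1.
move=> /ucm_inj gD _; have := congr1 (fun g : generator => tag (val g)) gD.
by rewrite gE.
Qed.

Lemma mon_inj n (E : chords n) (D : diagram n) :
  (0 < n)%N -> mon E = mon D -> E = D.
Proof.
move=> n0 eqm; have : mdeg (mon E) = 1%N by rewrite eqm mdeg_mon n0.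
move: eqm; rewrite [mon E]/mon; case: insubP => [E' _ <-|_ _]; last by rewrite mdeg1.
rewrite -[monD _]/(monD (mk_any E')) => + _; have <- : mon E' = monD (mk_any E').
  by rewrite /mon valK.
rewrite !(mon_diagram _ n0) => /ucm_inj /(congr1 val) /= /eqP.
by rewrite -[mk_any D]/(Tagged diagram D) eq_Tagged => /eqP/(congr1 (@chords_of n)).
Qed.

End Monomials.

(** * The quotient of a cut along one chord *)

Section Quotient.
Variable n : nat.
Implicit Types (G C : chords n) (u v w s : 'I_n.+1).

(** The degree k is a variable because the degree of a quotient is equal to 1
    only up to a proof. *)
Lemma pair_degree1 k (x y : 'I_k.+1) : k = 1%N -> x != y ->
  mon [set [set x; y]] = mon a_chords /\
  goes_out [set [set x; y]] [set x; y] y = (y != ord0).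
Proof.
move=> k1; subst k => xy; have exy : [set x; y] = [set ord0; ord_max].
  apply/eqP; rewrite eqEsubset; apply/andP; split; apply/subsetP=> z.
    by move=> _; case: z => [[|[|]]] // ?; rewrite !inE -!(inj_eq (@ord_inj _)).
  move=> _; move: xy; rewrite !inE -!(inj_eq (@ord_inj _)).
  by have := ltn_ord z; have := ltn_ord x; have := ltn_ord y; lia.
split; first by rewrite exy.
rewrite /goes_out set11 /=; transitivity (x == ord0); last first.
  move: xy; rewrite -!(inj_eq (@ord_inj _)).
  by have := ltn_ord x; have := ltn_ord y; rewrite /=; lia.
rewrite setDv; apply/existsP/eqP => [[z /andP[/eqP exz]]|x0].
  have -> : z = x.
    by case/set2_eqP: exz => -[? ?] //; subst; rewrite eqxx in xy.
  by case/connectP=> [[|z' p] //= /andP[/andP[_]]]; rewrite inE.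
by exists x; rewrite setUC eqxx x0 connect0.
Qed.

(** The least side of the face of {u, v} that does not contain side 0. *)
Definition min_outside u v : 'I_n.+1 := if u == ord0 then v else u.

Lemma val_min_outside u v :
  min_outside u v = (if u == 0%N :> nat then v else u) :> nat.
Proof. by rewrite /min_outside -(inj_eq (@ord_inj _)); case: eqP. Qed.

Lemma min_sides1 u v : (u < v)%N ->
  min_sides [set [set u; v]] = [set ord0; min_outside u v].
Proof.
move=> uv; apply/setP=> s; rewrite !inE.
have sf s' : same_face [set [set u; v]] s s' = ((u <= s < v)%N == (u <= s' < v)%N).
  by rewrite same_face1 !under_arc // !inE.
have min0 : (s == ord0) = (s == 0%N :> nat) by [].
have minm : (s == min_outside u v) = (s == min_outside u v :> nat) by [].
rewrite min0 minm val_min_outside {min0 minm}.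
apply/forallP/idP => [min|ms s'].
  have := min ord0; have := min u; have := min v; rewrite !sf leqnn uv ltnn andbF /=.
  clear - uv; have [u0|u0] := eqVneq (u : nat) 0%N;
    have [us|us] := boolP (u <= s < v)%N; lia.
apply/implyP; rewrite sf; move: ms; clear - uv.
by have [u0|u0] := eqVneq (u : nat) 0%N; lia.
Qed.

Lemma min_outside_gt0 u v : (u < v)%N -> (0 < min_outside u v)%N.
Proof. by rewrite val_min_outside; case: eqP => [->|]; lia. Qed.

Lemma card_min_sides1 u v : (u < v)%N -> #|min_sides [set [set u; v]]| = 2.
Proof.
move=> /[dup] uv /min_outside_gt0 m0; rewrite min_sides1 // cards2.
by rewrite -(inj_eq (@ord_inj _)) /= ltn_eqF.
Qed.

Lemma contract_min_sides u v w : (u < v)%N ->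
  contract (min_sides [set [set u; v]]) w = (0 < w <= min_outside u v)%N :> nat.
Proof.
move=> /[dup] uv /min_outside_gt0 m0; have c2 := card_min_sides1 uv.
rewrite val_contract ?c2 // /sides_below.
have -> : #|[set s in min_sides [set [set u; v]] | (s < w)%N]| =
    ((0 < w) + (min_outside u v < w))%N.
  rewrite min_sides1 // -sum1dep_card big_mkcondr /=.
  rewrite big_setU1 ?big_set1 /=; first by case: (0 < w)%N; case: (_ < w)%N.
  by rewrite inE -(inj_eq (@ord_inj _)) /= ltn_eqF.
by case: (ltnP 0%N w) => w0; case: (ltnP (min_outside u v) w) => //=; lia.
Qed.

(** The vertices contracted to the non-root vertex of the quotient are those from
    1 to [min_outside u v], and only one endpoint of {u, v} is among them. *)
Lemma one_chord u v b : (u < v)%N -> b = u \/ b = v ->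
  let r := r_part [set [set u; v]] in
  let f := contract (min_sides [set [set u; v]]) in
  mon r = mon a_chords /\
  goes_out r (f @: [set u; v]) (f b) = (b == min_outside u v).
Proof.
move=> uv buv r f; have c2 : (#|min_sides [set [set u; v]]|.-1 = 1)%N.
  by rewrite card_min_sides1.
have mE := val_min_outside u v.
have fuv : f u != f v.
  rewrite -(inj_eq (@ord_inj _)) !contract_min_sides // mE.
  by clear - uv; have [u0|u0] := eqVneq (u : nat) 0%N; lia_cases.
have rE : r = [set [set f u; f v]].
  by rewrite /r /r_part imset_set1 imsetU1 imset_set1.
have fb : (f b != ord0) = (b == min_outside u v).
  rewrite -!(inj_eq (@ord_inj _)) contract_min_sides // mE /=.
  by case: buv => ->; clear - uv; have [u0|u0] := eqVneq (u : nat) 0%N; lia_cases.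
rewrite rE imsetU1 imset_set1 -fb.
case: buv {fb} => ->; last exact: pair_degree1.
by rewrite [[set f u; f v]]setUC; apply: pair_degree1; rewrite // eq_sym.
Qed.

Lemma goes_out_root G c : is_diagram G -> ~~ goes_out G c ord0.
Proof.
case/is_diagramP=> _ pG _ fG; apply/andP=> -[cG /existsP[v /andP[/eqP cv]]].
have v0 : ord0 != v.
  by have := forall_inP pG _ cG; rewrite cv cards2; case: (_ != _).
by rewrite connect_adjC cv; apply/negP/fG; rewrite -?cv.
Qed.

(** In the quotient {u, v} goes out of u, unless u is the root; a chord at the
    root is oriented towards it both in G and in the quotient. *)
Lemma k_part1 G u v : is_diagram G -> (u < v)%N ->
  k_part G [set [set u; v]] = (u != ord0) && goes_out G [set u; v] v.
Proof.
move=> dG uv; rewrite /k_part; set c := [set u; v].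
set Q := (X in #|[set c' in _ | X c']|).
have -> : [set c' in [set c] | Q c'] = if Q c then [set c] else set0.
  apply/setP=> c'; rewrite inE in_set1; have [->|ne] := eqVneq c' c.
    by case: (Q c); rewrite !inE ?eqxx.
  by case: (Q c); rewrite !inE // (negPf ne).
rewrite (_ : Q c = (u != ord0) && goes_out G c v);
  first by case: ifP; rewrite ?cards1 ?cards0.
have [_ gu] := one_chord uv (or_introl erefl).
have [_ gv] := one_chord uv (or_intror erefl).
rewrite /Q; apply/existsP/andP=> [[a /existsP[b /and3P[/eqP ab Ga]]]|[u0 Gv]].
  have [[ua vb]|[ub va]] := set2_eqP ab.
    rewrite -vb gv /min_outside; have [u0 _|_ /eqP vu] := eqVneq u ord0.
      by have := goes_out_root c dG; rewrite -u0 ua Ga.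
    by rewrite vu ltnn in uv.
  rewrite -ub gu /min_outside va Ga; have [u0 /eqP uv'|//] := eqVneq u ord0.
  by rewrite uv' va ltnn in uv.
exists v; apply/existsP; exists u; rewrite {1}/c setUC eqxx Gv gu.
by rewrite /min_outside (negPf u0) eqxx.
Qed.
End Quotient.
(** * The coefficients of the coproduct *)

Section Cuts.
Variable n : nat.
Implicit Types (C G : chords n) (u v s : 'I_n.+1).

Lemma pair_lt (c : {set 'I_n.+1}) : #|c| = 2 ->
  exists u v, (u < v)%N /\ c = [set u; v].
Proof.
move=> /eqP/cards2P[u [v [uv ->]]].
have := uv; rewrite -(inj_eq (@ord_inj _)) neq_ltn => /orP[lt|lt].
  by exists u, v.
by exists v, u; rewrite setUC.
Qed.

(** Every face has a minimal side, so a lower bound on the number of faces is one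
    on the degree of the quotient. *)
Lemma min_side_of C s : exists2 m, m \in min_sides C & same_face C s m.
Proof.
have ss : same_face C s s by apply/forall_inP.
case: (arg_minnP (fun m : 'I_n.+1 => m : nat) ss) => m sm min; exists m => //.
rewrite inE; apply/forallP=> s'; apply/implyP=> ms'; apply: min.
apply/forall_inP=> c cC.
by rewrite (eqP (forall_inP sm c cC)) (eqP (forall_inP ms' c cC)).
Qed.

Lemma same_face_under C c m s : c \in C -> same_face C s m -> under c s = under c m.
Proof. by move=> cC /forall_inP/(_ c cC)/eqP. Qed.

(** Two distinct chords separate three sides from one another, so that only the
    cuts along a single chord have a quotient of degree one. *)
Lemma two_faces C : pairs C -> #|min_sides C| = 2 -> exists c, C = [set c].
Proof.
move=> pC m2; have [C0|[c cC]] := set_0Vmem C.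
  suff : #|min_sides C| = 1%N by rewrite m2.
  rewrite (_ : min_sides C = [set ord0]) ?cards1 //; apply/setP=> s.
  rewrite !inE; apply/forallP/eqP => [/(_ ord0)/implyP s0|-> s' //]; last exact/implyP.
  apply/ord_inj/eqP; rewrite -leqn0; apply: s0.
  by apply/forall_inP=> c; rewrite C0 inE.
exists c; apply/eqP; rewrite eq_sym eqEcard sub1set cC cards1 leqNgt.
apply/negP=> C2; have : (0 < #|C :\ c|)%N.
  by move: C2; rewrite (cardsD1 c) cC.
rewrite card_gt0 => /set0Pn[c' /setD1P[cc' c'C]].
wlog [s us us'] : c c' cC c'C cc' {C2} / exists2 s, under c s & ~~ under c' s.
  have [u [v [uv cE]]] := pair_lt (eqP (forall_inP pC c cC)).
  have [u' [v' [uv' cE']]] := pair_lt (eqP (forall_inP pC c' c'C)).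
  have un s : under c s = (u <= s < v)%N by rewrite cE under_arc // inE.
  have un' s : under c' s = (u' <= s < v')%N by rewrite cE' under_arc // inE.
  move=> wl; have [uu'|uu'] := eqVneq u u'.
    have vv' : v != v' by apply: contra_neq cc' => vv'; rewrite cE' cE uu' vv'.
    move: vv'; rewrite -(inj_eq (@ord_inj _)) neq_ltn => /orP[vv'|vv'].
      apply: (wl c' c) => //; first by rewrite eq_sym.
      by exists v; rewrite ?un ?un' -?uu' ?ltnn ?andbF // vv' ltnW.
    apply: (wl c c') => //.
    by exists v'; rewrite ?un ?un' ?uu' ?ltnn ?andbF // vv' ltnW.
  move: uu'; rewrite -(inj_eq (@ord_inj _)) neq_ltn => /orP[uu'|uu'].
    apply: (wl c c') => //.
    by exists u; rewrite ?un ?un' ?leqnn ?uv // leqNgt uu'.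
  apply: (wl c' c) => //; first by rewrite eq_sym.
  by exists u'; rewrite ?un ?un' ?leqnn ?uv' // leqNgt uu'.
have [u' [v' [uv' cE']]] := pair_lt (eqP (forall_inP pC c' c'C)).
have [u [v [uv cE]]] := pair_lt (eqP (forall_inP pC c cC)).
have un1 : under c' u' by rewrite cE' under_arc // inE leqnn.
have un2 : ~~ under c' ord_max by rewrite cE' under_arc // ord_max_arc.
have un3 : ~~ under c ord_max by rewrite cE under_arc // ord_max_arc.
have [a aM sa] := min_side_of C s.
have [b bM sb] := min_side_of C u'.
have [m mM sm] := min_side_of C ord_max.
rewrite (same_face_under cC sa) in us; rewrite (same_face_under c'C sa) in us'.
rewrite (same_face_under c'C sb) in un1.
rewrite (same_face_under cC sm) in un3; rewrite (same_face_under c'C sm) in un2.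
have : (#|[set a; b; m]| <= #|min_sides C|)%N.
  apply/subset_leq_card/subsetP=> z; rewrite !in_setU !in_set1.
  by case/orP=> [/orP[]|] /eqP->.
rewrite m2 setUC cardsU1 cards2 !inE negb_or.
have -> : a != b by apply: contraTneq un1 => <-.
have -> : m != a by apply: contraTneq us => <-.
by have -> : m != b by apply: contraTneq un1 => <-.
Qed.

Lemma q_part1 G u v : (u < v)%N ->
  q_part G [set [set u; v]] =
  mmul (mon (q_face G [set [set u; v]] (arc u v)))
       (mon (q_face G [set [set u; v]] (~: arc u v))).
Proof.
move=> uv; rewrite /q_part faces1 // big_setU1 ?big_set1 //.
rewrite inE; apply/eqP=> /setP/(_ u).
by rewrite !inE leqnn uv.
Qed.

Lemma mon_degree0 k (E : chords k) : k = 0%N -> mon E = mone.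
Proof. by move=> k0; subst k; exact: mon_deg0. Qed.

(** The cut along {u, v} leaves a product of two diagrams, one for each face; it
    can only be a generator if one of them has degree zero, that is, if one face
    has a single side. *)
Lemma q_part_generator G u v m (D : diagram m) : is_diagram G -> (0 < m)%N ->
    (u < v)%N -> [set u; v] \in G ->
    q_part G [set [set u; v]] = mon D ->
  n = m.+1 /\ ((v = u.+1 :> nat) \/ (u = 0%N :> nat /\ v = n :> nat)).
Proof.
move=> dG m0 uv cG; rewrite q_part1 // => eqm.
have [dA dC] := q_face_diagrams dG uv cG.
have := congr1 (fun M => mdeg M) eqm; rewrite /= mdegM mdeg_mon.
have /= -> := mdeg_mon (Diagram dA); have /= -> := mdeg_mon (Diagram dC).
have kA := card_arc u v; have kC := card_arcC u v; have vn := ltn_ord v.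
have [A1|A1] := posnP #|arc u v|.-1; have [C1|C1] := posnP #|~: arc u v|.-1.
- by rewrite m0.
- move: eqm; rewrite (mon_degree0 _ A1) mul1m => /(mon_degree m0) mE _.
  rewrite kC in mE; rewrite kA in A1.
  by clear - A1 uv vn mE; lia.
- move: eqm; rewrite [X in mmul _ X](mon_degree0 _ C1) mulm1 => /(mon_degree m0) mE _.
  rewrite kA in mE; rewrite kC in C1.
  by clear - C1 uv vn mE; lia.
by rewrite m0.
Qed.

End Cuts.
Section SideCuts.
Variable n : nat.
Implicit Types (j : 'I_n.+2) (G C : chords n.+1) (D : chords n).

(** The endpoints of [edge j] in increasing order. *)
Definition edge_lo j : 'I_n.+2 := if j == ord_max then ord0 else j.
Definition edge_hi j : 'I_n.+2 := if j == ord_max then ord_max else ordS j.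

Lemma eq_ord_max j : (j == ord_max) = (j == n.+1 :> nat).
Proof. by []. Qed.

Lemma val_edge_lo j : edge_lo j = (if j == n.+1 :> nat then 0 else j)%N :> nat.
Proof. by rewrite /edge_lo eq_ord_max; case: eqP. Qed.

Lemma val_edge_hi j : edge_hi j = (if j == n.+1 :> nat then n.+1 else j.+1)%N :> nat.
Proof.
by rewrite /edge_hi eq_ord_max; case: eqP => // /eqP/negPf; rewrite val_ordS => ->.
Qed.

Lemma edge_lt j : (edge_lo j < edge_hi j)%N.
Proof. by rewrite val_edge_lo val_edge_hi; case: eqP. Qed.

Lemma edgeE j : edge j = [set edge_lo j; edge_hi j].
Proof.
rewrite /edge_lo /edge_hi; case: eqP => [->|//]; rewrite /edge setUC.
by congr [set _; _]; apply: ord_inj; rewrite val_ordS eqxx.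
Qed.

Lemma in_edge_arc j s :
  (s \in arc (edge_lo j) (edge_hi j)) = (s == j) (+) (j == ord_max).
Proof.
rewrite inE val_edge_lo val_edge_hi eq_ord_max -(inj_eq (@ord_inj _)).
by have := ltn_ord s; case: eqP => [->|] /=; lia.
Qed.

Lemma under_edge j s : under (edge j) s = (s == j) (+) (j == ord_max).
Proof. by rewrite edgeE under_arc ?edge_lt // in_edge_arc. Qed.

Lemma edge_inj : (0 < n)%N -> injective (@edge n).
Proof.
move=> n0 i j /set2_eqP[[] //|[ij ji]]; exfalso.
have := congr1 (@nat_of_ord _) ij; have := congr1 (@nat_of_ord _) ji.
by rewrite !val_ordS; have := ltn_ord i; have := ltn_ord j; lia_cases.
Qed.

Lemma below_but_one j (w : 'I_n.+2) : sides_below [set~ j] w = (w - (j < w))%N.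
Proof.
have cw : #|[set s : 'I_n.+2 | (0 <= s < w)%N]| = w.
  by rewrite card_interval ?subn0 // ltnW.
rewrite -[X in (X - _)%N]cw (cardsD1 j) inE /= addKn /sides_below.
by apply: eq_card => s; rewrite !inE.
Qed.

Lemma card_but_one j : #|[set~ j]| = n.+1.
Proof. by rewrite cardsC1 card_ord. Qed.

Lemma contract_but_one j w : contract [set~ j] w = shrink j w :> nat.
Proof.
rewrite val_contract ?card_but_one // below_but_one val_shrink.
by have := ltn_ord w; have := ltn_ord j; lia_cases.
Qed.

Lemma mon_cast N k m (f : 'I_N.+1 -> 'I_k.+1) (g : 'I_N.+1 -> 'I_m.+1) (S : chords N) :
    k = m -> (forall w, f w = g w :> nat) ->
  mon [set f @: d | d : {set 'I_N.+1} in S] = mon [set g @: d | d : {set 'I_N.+1} in S].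
Proof.
move=> km; subst k => fg; congr mon; apply: eq_imset => d; apply: eq_imset => w.
exact/ord_inj/fg.
Qed.

(** The face made of side j alone has degree zero, and contraction onto the other
    face is the contraction of side j. *)
Lemma q_part_edge j G : q_part G [set edge j] = mon (contraction j G).
Proof.
have facesE : faces [set edge j] = [set [set j]; [set~ j]].
  have arcE : arc (edge_lo j) (edge_hi j) = if j == ord_max then [set~ j] else [set j].
    by apply/setP=> s; rewrite in_edge_arc; case: (j == _); rewrite !inE ?addbT ?addbF.
  by rewrite edgeE faces1 ?edge_lt // arcE; case: ifP => _; rewrite // setCK setUC.
have ne : [set j] \notin [set [set~ j]].
  by rewrite inE; apply/eqP=> /setP/(_ j); rewrite !inE eqxx.
rewrite /q_part facesE big_setU1 //= big_set1 mon_degree0 ?cards1 //= mul1m.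
have -> : q_face G [set edge j] [set~ j] =
    [set contract [set~ j] @: d | d : {set 'I_n.+2} in G :\ edge j].
  apply/setP=> d'; apply/imsetP/imsetP=> -[d dG ->]; exists d => //.
    by move: dG; rewrite inE => /andP[].
  rewrite inE dG; apply/forall_inP=> c /set1P->.
  apply/forall_inP=> s; rewrite in_setC1 => sj; apply/forall_inP=> w wd.
  apply/implyP; rewrite !inE negb_or => /andP[wj _].
  by rewrite !under_edge (negPf sj) (negPf wj).
have degF : #|[set~ j]|.-1 = n by rewrite card_but_one.
by rewrite (mon_cast _ degF (contract_but_one j)).
Qed.

Lemma a_chords_diagram : is_diagram a_chords.
Proof.
apply: connected_diagram; rewrite ?cards1 //; last first.
  by apply/noncrossingP=> u v u' v' _ _; have := ltn_ord v'; lia.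
move=> u v.
  have [-> //|uv] := eqVneq u v; apply: connect1; rewrite /adjacent uv inE.
  apply/eqP/setP=> s; rewrite !inE; move: uv; rewrite -!(inj_eq (@ord_inj _)).
  by have := ltn_ord s; have := ltn_ord u; have := ltn_ord v; rewrite /=; lia.
Qed.

Lemma cut_one_chord m (G : diagram m) (C : chords m) :
  C \subset chords_of G -> mon (r_part C) = mon a_chords ->
  exists u v : 'I_m.+1,
    [/\ (u < v)%N, [set u; v] \in chords_of G & C = [set [set u; v]]].
Proof.
move=> CG rC; have [_ pG _ _] := is_diagramP _ (diagramP G).
have /two_faces[] : #|min_sides C| = 2.
- by have := mon_degree (D := Diagram a_chords_diagram) isT rC; case: #|_| => [|[|[]]].
- by apply/pairsP=> c /(subsetP CG)/(pairsP _ pG).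
move=> c Cc; subst C; have cG : c \in chords_of G by rewrite -sub1set.
have [u [v [uv cE]]] := pair_lt (eqP (forall_inP pG c cG)).
by exists u, v; rewrite -cE.
Qed.

(** A quotient of degree one forces a single chord, and then a generator forces
    this chord to be parallel to a side. *)
Lemma cut_edges (G : diagram n.+1) (D : diagram n) C : (0 < n)%N ->
  (C \subset chords_of G) && ((q_part G C, mon (r_part C)) == (mon D, mon a_chords)) =
  (C \in [set [set edge j] | j in
             [set j | (edge j \in chords_of G) && (contraction j G == D)]]).
Proof.
move=> n0; have dG := diagramP G.
rewrite xpair_eqE; apply/and3P/imsetP => [[CG /eqP qC /eqP rC]|[j]].
  have [u [v [uv cG CE]]] := cut_one_chord CG rC; subst C.
  have [_ uv'] := q_part_generator dG n0 uv cG qC.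
  have [j uvj] : exists j, [set u; v] = edge j.
    case: uv' => [vu|[u0 vn]].
      exists u; congr [set _; _]; apply: ord_inj; rewrite val_ordS.
      by have := ltn_ord v; lia_cases.
    exists ord_max; rewrite edgeE /edge_lo /edge_hi eqxx.
    by congr [set _; _]; apply: ord_inj.
  exists j; rewrite ?uvj // inE -uvj cG; move: qC; rewrite uvj q_part_edge.
  by move/(mon_inj n0)->; rewrite eqxx.
rewrite inE => /andP[jG /eqP GD] ->; split; first by rewrite sub1set.
  by rewrite q_part_edge GD.
by rewrite edgeE; have [->] := one_chord (edge_lt j) (or_introl erefl).
Qed.

Section Coefficients.
Variables (K : fieldType) (x : K).

Lemma coef_edges (D : diagram n) (G : diagram n.+1) : (0 < n)%N ->
  coef x D G = \sum_(j | (edge j \in chords_of G) && (contraction j G == D))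
                 x ^+ k_part G [set edge j].
Proof.
move=> n0; rewrite /coef /Delta raddf_sum /=.
under eq_bigr => C _ do rewrite mcoeffU mulrb.
rewrite -big_mkcondr /= (eq_bigl _ _ (fun C => cut_edges G D C n0)).
rewrite big_imset /=; first by apply: eq_bigl => j; rewrite inE.
by move=> i j _ _ /set1_inj/(edge_inj n0).
Qed.

Lemma coef_degree (D : diagram n) m (G : diagram m) : (0 < n)%N -> m != n.+1 ->
  coef x D G = 0.
Proof.
move=> n0 mn; rewrite /coef /Delta raddf_sum /= big1 // => C CG.
rewrite mcoeffU mulrb ifN //; apply: contra mn.
rewrite xpair_eqE => /andP[/eqP qC /eqP rC].
have [u [v [uv cG CE]]] := cut_one_chord CG rC; subst C.
by have [/eqP] := q_part_generator (diagramP G) n0 uv cG qC.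
Qed.

(** A diagram that contributes to the image of D has degree one more, so the sum
    over all diagrams is finite. *)
Lemma L_finite (D : diagram n) : (0 < n)%N ->
  L x D = \sum_(G : diagram n.+1) coef x D G *: diag K G.
Proof.
move=> n0; rewrite /L.
have inj : injective (@mk_any n.+1).
  by move=> G G' /eqP; rewrite -[mk_any G']/(Tagged diagram G') eq_Tagged => /eqP.
rewrite (@fsbigop.fsbigE _ _ _ _ _ (map (@mk_any n.+1) (enum {: diagram n.+1}))) /=.
- rewrite big_map big_enum_cond /=; apply: eq_bigl => G.
  by rewrite classical_sets.in_setT.
- by rewrite map_inj_uniq ?enum_uniq.
- by [].
case=> m G _; have [mn|mn _] := eqVneq m n.+1; last by rewrite coef_degree ?scale0r.
by subst m; rewrite -[existT _ _ G]/(mk_any G) map_f // mem_enum.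
Qed.

End Coefficients.
End SideCuts.
(** * Orientation towards the root *)

Section Orientation.
Variable n : nat.
Implicit Types (D : chords n) (a d : {set 'I_n.+1}) (i u v w : 'I_n.+1).

Definition away i D : chords n := [set d in D | i \notin d].

Lemma connect_away D i u v : connect (adjacent D) u v ->
  connect (adjacent D) u i \/ connect (adjacent (away i D)) u v.
Proof.
case/connectP=> p pp lv; have [ip|ip] := boolP (i \in u :: p).
  by left; apply: path_connect pp _ ip.
right; apply/connectP; exists p => //; elim: p u ip pp {lv} => //= w p IHp u.
rewrite !inE !negb_or => /and3P[iu iw ip] /andP[/andP[uw uwD] pw].
by rewrite /adjacent uw !inE uwD negb_or iu iw IHp // inE negb_or iw.
Qed.

(** In a tree the way to the root from the far end of the chord going out of i
    does not come back to i. *)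
Lemma goes_out_away D a i : is_diagram D -> goes_out D a i ->
  exists v, [/\ v != i, a = [set i; v], a \in D & connect (adjacent (away i D)) v ord0].
Proof.
move=> dD /andP[aD /existsP[v /andP[/eqP aE v0]]]; have [_ pD _ fD] := is_diagramP _ dD.
have iv : i != v by have := forall_inP pD _ aD; rewrite aE cards2; case: (_ != _).
exists v; rewrite eq_sym; split=> //; case: (connect_away i v0) => [vi|].
  have ivD : [set i; v] \in D by rewrite -aE.
  by have /negP[] := fD i v iv ivD; rewrite -aE connect_adjC.
by apply: connect_adjW; apply/subsetP=> d; rewrite !inE => /andP[/andP[_ ->]].
Qed.

(** Two chords going out of i would join i to the root in two ways. *)
Lemma goes_out_inj D a a' i : is_diagram D ->
  goes_out D a i -> goes_out D a' i -> a = a'.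
Proof.
move=> dD /[dup] /andP[aD /existsP[v /andP[/eqP aE v0]]] _.
case/(goes_out_away dD)=> v' [iv' aE' aD' v0']; have [_ pD _ fD] := is_diagramP _ dD.
have iv : i != v by have := forall_inP pD _ aD; rewrite aE cards2; case: (_ != _).
apply/eqP/negPn/negP=> aa'; have /negP[] : ~~ connect (adjacent (D :\ a)) i v.
  by rewrite aE; apply: fD; rewrite // -aE.
have iv'a : adjacent (D :\ a) i v' by rewrite /adjacent eq_sym iv' -aE' !inE eq_sym aa'.
apply: connect_trans (connect1 iv'a) _; rewrite connect_adjC; apply: connect_trans v0 _.
rewrite connect_adjC; apply: connect_adjW v0'; apply/subsetP=> d.
rewrite !inE => /andP[-> id]; rewrite andbT; apply: contraNneq id => ->.
by rewrite aE set21.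
Qed.

Lemma goes_out_exists D i : is_diagram D -> i != ord0 -> exists a, goes_out D a i.
Proof.
move=> dD i0; have /connectP[p0 pp0 lp0] := diagram_connected dD i ord0.
case/shortenP: pp0 lp0 => [[|v p]] /= pp up _ lp; first by rewrite lp eqxx in i0.
case/andP: pp => /andP[iv ivD] pp; exists [set i; v]; rewrite /goes_out ivD /=.
apply/existsP; exists v; rewrite eqxx; apply/connectP; exists p => //.
by rewrite setUC; apply: path_avoid pp; case/andP: up.
Qed.

Lemma label_unique D i : is_diagram D -> i != ord0 ->
  exists! l : nat, (1 <= l <= fertility D i)%N
    /\ goes_out D (nth set0 (fan D i) l.-1) i.
Proof.
move=> dD i0; have [_ pD _ _] := is_diagramP _ dD.
have [a ga] := goes_out_exists dD i0; have [v [_ aE aD _]] := goes_out_away dD ga.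
have af : a \in fan D i by rewrite mem_fan // aD aE set21.
exists (index a (fan D i)).+1; split=> [|l [/andP[l1 lf] gl]].
  by rewrite /= nth_index // -size_fan // index_mem.
rewrite -(goes_out_inj dD gl ga) index_uniq ?fan_uniq ?prednK //.
by rewrite size_fan // prednK.
Qed.

(** The way to the root from the far end of a lifts to the expansion, so the copy
    of the split vertex that keeps a reaches the root without the new chord, and
    the other copy has to pass through it. *)
Lemma goes_out_expand (j : 'I_n.+2) (P : pred {set 'I_n.+1}) D a :
    is_diagram D -> is_diagram (expand j P D) -> pinch j != ord0 ->
    goes_out D a (pinch j) ->
  goes_out (expand j P D) (edge j) (ordS j) = P a.
Proof.
set G := expand j P D; set i := pinch j => dD dG i0 ga.
have [_ pD _ _] := is_diagramP _ dD; have [_ _ _ fG] := is_diagramP _ dG.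
have [v [vi aE aD v0]] := goes_out_away dD ga.
have Gj : G :\ edge j = [set unshrink j (P d) @: d | d : {set 'I_n.+1} in D].
  exact: expand_setD.
have jG : edge j \in G := edge_expand j P D.
have lift0 : lift j ord0 = ord0.
  apply: ord_inj; rewrite [LHS]val_lift /=; move: i0.
  by rewrite -(inj_eq (@ord_inj _)) val_pinch /=; clear; lia_cases.
have far : connect (adjacent (G :\ edge j)) (lift j v) ord0.
  rewrite -lift0; case/connectP: v0 => p; elim: p v {vi aE} => [|w p IHp] v /=.
    by move=> _ ->.
  case/andP=> vw pw lw; apply: connect_trans (IHp w pw lw); apply: connect1.
  case/andP: vw => vw; rewrite !inE negb_or => /and3P[vwD iv iw].
  rewrite /adjacent (inj_eq (@lift_inj _ j)) vw Gj; apply/imsetP.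
  exists [set v; w] => //; rewrite imsetU1 imset_set1 /unshrink.
  by rewrite ![_ == pinch j]eq_sym (negPf iv) (negPf iw).
have near : adjacent (G :\ edge j) (unshrink j (P a) i) (lift j v).
  rewrite /adjacent Gj; apply/andP; split.
    apply: contra_neq vi => eq_lv.
    by rewrite -(unshrinkK j (P a) i) eq_lv shrink_lift.
  apply/imsetP; exists a => //.
  rewrite [in RHS](_ : _ @: a = unshrink j (P a) @: [set i; v]);
    last by rewrite -aE.
  rewrite imsetU1 imset_set1; congr [set _; _].
  by rewrite /unshrink (negPf vi).
have {near far} root : connect (adjacent (G :\ edge j)) (unshrink j (P a) i) ord0.
  exact: connect_trans (connect1 near) far.
have sep : ~~ connect (adjacent (G :\ edge j)) j (ordS j).
  by apply: fG; rewrite ?ordS_neq.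
rewrite /goes_out jG /=; transitivity (connect (adjacent (G :\ edge j)) j ord0).
  apply/existsP/idP => [[w /andP[/eqP ew]]|j0]; last first.
    by exists j; rewrite j0 andbT /edge setUC.
  case/set2_eqP: ew => -[jw Sw]; last by rewrite jw.
  by have := ordS_neq j; rewrite -jw eqxx.
case Pa: (P a) root; rewrite /unshrink eqxx /=; first by [].
rewrite lift_pinch => S0; apply: contraNF sep => j0; apply: connect_trans j0 _.
by rewrite connect_adjC.
Qed.

End Orientation.
(** * The map L *)

Section Insertions.
Variable n : nat.
Implicit Types (i : 'I_n.+1) (j : 'I_n.+2) (D : chords n) (t : nat).

Lemma insert_expand j (mv : {set 'I_n.+1} -> 'I_n.+1 -> nat)
    (P : pred {set 'I_n.+1}) D :
    (forall c u, mv c u = unshrink j (P c) u :> nat) ->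
  insert_chord (edge j) mv D = expand j P D.
Proof.
move=> mvE; congr (_ |: _); apply: eq_imset => c; apply: eq_imset => u.
by apply: ord_inj; rewrite mvE inord_val.
Qed.

Lemma val_unshrink j b (u : 'I_n.+1) : unshrink j b u =
  (if (u == pinch j :> nat) && b then j : nat else u + (j <= u))%N :> nat.
Proof. by rewrite /unshrink -(inj_eq (@ord_inj _)); case: ifP; rewrite ?val_lift. Qed.

Lemma pinch_widen i : pinch (widen_ord (leqnSn _) i) = i.
Proof. by apply: ord_inj; rewrite val_pinch /= ltn_eqF. Qed.

Lemma pinch_max : pinch (ord_max : 'I_n.+2) = ord0.
Proof. by apply: ord_inj; rewrite val_pinch eqxx. Qed.

Lemma side_chord_edge i : side_chord i = edge (widen_ord (leqnSn _) i).
Proof.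
have := ltn_ord i => ni; congr [set _; _]; apply: ord_inj.
  by rewrite inordK //= ltnW.
by rewrite val_ordS inordK //= ltn_eqF.
Qed.

Lemma Phi_expand i t D : Phi i t D = expand_fan (widen_ord (leqnSn _) i) t D.
Proof.
rewrite /Phi side_chord_edge /expand_fan pinch_widen; apply: insert_expand => c u.
rewrite val_unshrink pinch_widen /=.
by case: (ltngtP u i) => [_|_|->] /=; rewrite ?addn0 ?addn1.
Qed.

Lemma Phi1_expand t D : Phi1 t D = expand_fan ord0 t D.
Proof.
have p0 : pinch (ord0 : 'I_n.+2) = ord0 by apply: ord_inj; rewrite val_pinch.
have e0 : [set ord0; inord 1] = edge (ord0 : 'I_n.+2).
  by congr [set _; _]; apply: ord_inj; rewrite val_ordS inordK.
rewrite /Phi1 e0 /expand_fan p0; apply: insert_expand => c u.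
rewrite val_unshrink p0 -(inj_eq (@ord_inj _)) /= addn1.
by case: (posnP u) => [->|u0] //=; case: ifP.
Qed.

Lemma Phi0_expand t D : Phi0 t D = expand_fan ord_max t D.
Proof.
have e0 : [set ord0; ord_max] = edge (ord_max : 'I_n.+2).
  by rewrite edgeE /edge_lo /edge_hi eqxx.
rewrite /Phi0 e0 /expand_fan pinch_max; apply: insert_expand => c u.
rewrite val_unshrink pinch_max -(inj_eq (@ord_inj _)) /= leqNgt ltn_ord addn0.
by case: (posnP u) => [->|u0] //=; case: ifP.
Qed.

End Insertions.

Section MapL.
Variables (K : fieldType) (x : K) (n : nat) (n_gt0 : (0 < n)%N) (D : diagram n).

Lemma expand_fan_diagram (j : 'I_n.+2) t : is_diagram (expand_fan j t D).
Proof.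
have [_ pD _ _] := is_diagramP _ (diagramP D).
exact/expand_diagram/take_fan_initial/pD/diagramP.
Qed.

Lemma L_expand : L x D =
  \sum_(j < n.+2) \sum_(t < (fertility D (pinch j)).+1)
     x ^+ k_part (expand_fan j t D) [set edge j] *: diag K (expand_fan j t D).
Proof.
rewrite L_finite //; under eq_bigr => G _ do rewrite coef_edges // scaler_suml.
rewrite (exchange_big_dep xpredT) //=; apply: eq_bigr => j _.
pose F (E : chords n.+1) := x ^+ k_part E [set edge j] *: diag K E.
transitivity
  (\sum_(E in [set expand_fan j t D | t : 'I_(fertility D (pinch j)).+1]) F E).
  2: by rewrite big_imset //= => t t' _ _; apply: (expand_fan_inj (diagramP D)).
rewrite -contraction_fibre ?diagramP //.
rewrite (reindex_omap (@chords_of n.+1) insub) /=; last first.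
  by move=> E; rewrite inE => /and3P[dE _ _]; rewrite insubT.
by apply: eq_bigl => G; rewrite inE diagramP valK eqxx andbT.
Qed.

(** A new chord at the root keeps its orientation. *)
Lemma k_part_root (j : 'I_n.+2) t : pinch j = ord0 ->
  k_part (expand_fan j t D) [set edge j] = 0%N.
Proof.
move=> /(congr1 (@nat_of_ord _)); rewrite val_pinch /= => j0.
rewrite edgeE k_part1 ?edge_lt ?expand_fan_diagram //.
by rewrite -(inj_eq (@ord_inj _)) val_edge_lo j0.
Qed.

Lemma L_Phi : L x D =
    \sum_(i < n.+1 | i != ord0) \sum_(0 <= t < (fertility D i).+1)
      x ^+ k_part (Phi i t D) [set side_chord i] *: diag K (Phi i t D)
    + \sum_(0 <= t < (fertility D ord0).+1)
        (diag K (Phi0 t D) + diag K (Phi1 t D)).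
Proof.
rewrite L_expand big_ord_recr /= (bigD1 ord0) //= addrAC addrC; congr (_ + _).
  apply: eq_bigr => i _; rewrite big_mkord; rewrite pinch_widen.
  by apply: eq_bigr => t _; rewrite side_chord_edge Phi_expand.
rewrite addrC big_mkord.
have w0 : widen_ord (leqnSn n.+1) ord0 = ord0 by apply: ord_inj.
have p0 : pinch (ord0 : 'I_n.+2) = ord0 by apply: ord_inj; rewrite val_pinch.
rewrite big_split /= w0 pinch_max p0; congr (_ + _); apply: eq_bigr => t _.
  by rewrite k_part_root ?pinch_max // scale1r Phi0_expand.
by rewrite k_part_root // scale1r Phi1_expand.
Qed.

Lemma k_part_Phi i t l : i != ord0 -> (1 <= l <= fertility D i)%N ->
  goes_out D (nth set0 (fan D i) l.-1) i ->
  k_part (Phi i t D) [set side_chord i] = (l <= t)%N.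
Proof.
move=> i0 /andP[l1 lf] gl; have [_ pD _ _] := is_diagramP _ (diagramP D).
set j := widen_ord (leqnSn n.+1) i; have pj : pinch j = i := pinch_widen i.
have jm : j != ord_max by rewrite -(inj_eq (@ord_inj _)) /= ltn_eqF.
rewrite Phi_expand side_chord_edge -/j edgeE k_part1 ?edge_lt ?expand_fan_diagram //.
rewrite -edgeE /edge_lo /edge_hi (negPf jm) -(inj_eq (@ord_inj _)) /=.
move: (i0); rewrite -(inj_eq (@ord_inj _)) /= => -> /=.
have dj := expand_fan_diagram j t; rewrite -pj in i0 gl.
rewrite (goes_out_expand (diagramP D) dj i0 gl) /= pj.
have l1f : (l.-1 < size (fan D i))%N by rewrite size_fan // prednK.
by rewrite in_take ?mem_nth // index_uniq ?fan_uniq // prednK.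
Qed.

End MapL.

Unset Implicit Arguments.

Theorem proposition38 (K : fieldType) (charK : [pchar K] =i pred0) (x : K)
    (n : nat) (n_gt0 : (0 < n)%N) (D : diagram n) :
  L x D =
    \sum_(i < n.+1 | i != ord0) \sum_(0 <= t < (fertility D i).+1)
      x ^+ k_part (Phi i t D) [set side_chord i] *: diag K (Phi i t D)
    + \sum_(0 <= t < (fertility D ord0).+1)
        (diag K (Phi0 t D) + diag K (Phi1 t D))
  /\ (forall i : 'I_n.+1, i != ord0 ->
        exists! l : nat, (1 <= l <= fertility D i)%N
          /\ goes_out D (nth set0 (fan D i) l.-1) i)
  /\ (forall l : 'I_n.+1 -> nat,
       (forall i : 'I_n.+1, i != ord0 ->
          (1 <= l i <= fertility D i)%N
          /\ goes_out D (nth set0 (fan D i) (l i).-1) i) ->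
       L x D =
         \sum_(i < n.+1 | i != ord0) \sum_(0 <= t < l i) diag K (Phi i t D)
         + x *: (\sum_(i < n.+1 | i != ord0)
                   \sum_(l i <= t < (fertility D i).+1) diag K (Phi i t D))
         + \sum_(0 <= t < (fertility D ord0).+1)
             (diag K (Phi0 t D) + diag K (Phi1 t D))).
Proof.
split; first exact: L_Phi.
split=> [i i0|l lP]; first exact: label_unique (diagramP D) i0.
rewrite L_Phi //; congr (_ + _); rewrite scaler_sumr -big_split /=.
apply: eq_bigr => i i0; have [lf gl] := lP i i0; have [l1 lf'] := andP lf.
have kE t := k_part_Phi t i0 lf gl.
pose term t := x ^+ k_part (Phi i t D) [set side_chord i] *: diag K (Phi i t D).
have low : \sum_(0 <= t < l i) term t = \sum_(0 <= t < l i) diag K (Phi i t D).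
  by apply: eq_big_nat => t /andP[_ lt_t]; rewrite /term kE leqNgt lt_t scale1r.
have high : \sum_(l i <= t < (fertility D i).+1) term t =
    \sum_(l i <= t < (fertility D i).+1) x *: diag K (Phi i t D).
  by apply: eq_big_nat => t /andP[le_t _]; rewrite /term kE le_t expr1.
by rewrite (big_cat_nat (leq0n (l i)) (leqW lf')) low high scaler_sumr.
Qed.
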